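(* Let $\varphi=\Phi I\in H^\infty$, where $I$ is inner and $\Phi$ is outer. If for every $0<\delta<1$ the interior of $L_\Phi^+(\delta)$ has nonempty intersection with $\sigma(I)$, then $\varphi$ is saturated.
   Context: $\mathbb{T}$ is the unit circle with normalized Lebesgue measure; $H^p$ ($1\le p\le\infty$) is the subspace of $L^p(\mathbb{T})$ of functions with Fourier coefficients supported on $\{0,1,2,\dots\}$, and $H^\infty_0$ is the subspace of $H^\infty$ of functions vanishing at the origin. A function $\varphi\in H^\infty$ is saturated if $\|\varphi\|_\infty = \inf_{f\in H^\infty_0}\|\varphi-\overline{f}\|_\infty$. Every $\varphi \in H^\infty$ factors as $\varphi=\Phi I$ with $I$ inner ($|I|=1$ a.e. on $\mathbb{T}$) and $\Phi$ outer. For a bounded function $\psi$ and $0\le\delta\le1$, $L_\psi^+(\delta)=\{e^{i\theta}\in\mathbb{T}: |\psi(e^{i\theta})|\ge \|\psi\|_\infty\delta\}$ (interior taken in $\mathbb{T}$). Writing $I=BS$ with $B$ a Blaschke product and $S$ singular inner, the spectrum $\sigma(I)\subseteq\mathbb{T}$ is the union of the accumulation points of the zeros of $B$ and the support of the singular measure of $S$. *)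

(* Defs.v *)
From HB Require Import structures.
From mathcomp Require Import all_boot all_order all_algebra.
From mathcomp Require Import all_classical all_reals all_analysis.
From mathcomp Require Import complex.

Set Implicit Arguments.
Unset Strict Implicit.
Unset Printing Implicit Defensive.

Import Order.TTheory GRing.Theory Num.Theory.
Import numFieldNormedType.Exports.
Local Open Scope classical_set_scope.
Local Open Scope ring_scope.

Section HardyDefs.
Variable R : realType.
Local Notation C := R[i].
Local Notation lam := (@lebesgue_measure R).

(* The unit circle T is parametrised by t in [0, 2 pi] via t |-> e^{it};   *)
(* functions on T are functions C -> C of which only the values on T matter. *)

Local Notation cRe := (@complex.Re R).
Local Notation cIm := (@complex.Im R).

Definition ceit (t : R) : C := Complex (cos t) (sin t).

Definition cexp (w : C) : C :=
  Complex (expR (cRe w) * cos (cIm w)) (expR (cRe w) * sin (cIm w)).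

Definition cmod (z : C) : R := Num.sqrt (cRe z ^+ 2 + cIm z ^+ 2).

Definition circ : set C := [set z | cmod z = 1].
Definition disc : set C := [set z | cmod z < 1].

Definition I02 : set R := `[0, 2 * pi]%classic.
Definition Ico02 : set R := `[0, 2 * pi[%classic.

Definition cint (d : measure_display) (T : measurableType d)
  (mu : {measure set T -> \bar R}) (D : set T) (g : T -> C) : C :=
  Complex (Rintegral mu D (fun t => cRe (g t))) (Rintegral mu D (fun t => cIm (g t))).

Definition tmean (g : R -> C) : C :=
  Complex ((2 * pi)^-1) 0 * cint lam I02 g.

Definition bmeas (f : C -> C) : Prop :=
  measurable_fun I02 (fun t => cRe (f (ceit t))) /\
  measurable_fun I02 (fun t => cIm (f (ceit t))).

Definition ess_norm (f : C -> C) : \bar R :=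
  ereal_inf [set M%:E | M in [set M : R | 0 <= M /\
     {ae lam, forall t, I02 t -> cmod (f (ceit t)) <= M}]].

Definition Linf (f : C -> C) : Prop := bmeas f /\ (ess_norm f < +oo)%E.

Definition fourier (f : C -> C) (n : int) : C :=
  tmean (fun t => f (ceit t) * ceit (- (n%:~R * t))).

Definition Hinf (f : C -> C) : Prop :=
  Linf f /\ forall n : int, (n < 0)%R -> fourier f n = 0.

Definition Hinf0 (f : C -> C) : Prop := Hinf f /\ fourier f 0 = 0.

Definition H1 (f : C -> C) : Prop :=
  bmeas f /\ lam.-integrable I02 (fun t => (cmod (f (ceit t)))%:E) /\
  forall n : int, (n < 0)%R -> fourier f n = 0.

Definition saturated (phi : C -> C) : Prop :=
  ess_norm phi =
  ereal_inf [set ess_norm (fun z => phi z - conjc (f z)) | f in Hinf0].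

Definition inner (I : C -> C) : Prop :=
  Hinf I /\ {ae lam, forall t, I02 t -> cmod (I (ceit t)) = 1}.

(* holomorphic extension to the disc (Cauchy integral) of an H^1 function *)
Definition ext (f : C -> C) (z : C) : C :=
  tmean (fun t => f (ceit t) * ceit t / (ceit t - z)).

Definition outer (F : C -> C) : Prop :=
  H1 F /\ {ae lam, forall t, I02 t -> F (ceit t) != 0} /\
  lam.-integrable I02 (fun t => (ln (cmod (F (ceit t))))%:E) /\
  exists c : C, cmod c = 1 /\
    forall z, disc z ->
      ext F z = c * cexp (tmean (fun t =>
         (ceit t + z) / (ceit t - z) * Complex (ln (cmod (F (ceit t)))) 0)).

(* Blaschke products: zero sequence a (None = no zero at this index) *)
Definition bfac (a : option C) (z : C) : C :=
  match a with
  | None => 1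
  | Some w => if w == 0 then z
              else Complex (cmod w) 0 / w * (w - z) / (1 - conjc w * z)
  end.

Definition bprod (a : nat -> option C) (N : nat) (z : C) : C :=
  \prod_(n < N) bfac (a n) z.

Definition blaschke_seq (a : nat -> option C) : Prop :=
  (forall n w, a n = Some w -> disc w) /\
  (\sum_(0 <= n <oo) (match a n with Some w => 1 - cmod w | None => 0 end)%:E
     < +oo)%E.

Definition blaschke_at (a : nat -> option C) (z w : C) : Prop :=
  (fun N => cRe (bprod a N z)) @ \oo --> cRe w /\
  (fun N => cIm (bprod a N z)) @ \oo --> cIm w.

Definition sing_meas (mu : {measure set R -> \bar R}) : Prop :=
  mu (~` Ico02) = 0%E /\ (mu setT < +oo)%E /\
  exists N : set R, measurable N /\ lam N = 0%E /\ mu (~` N) = 0%E.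

Definition sing_inner (mu : {measure set R -> \bar R}) (z : C) : C :=
  cexp (- cint mu Ico02 (fun t => (ceit t + z) / (ceit t - z))).

Definition spectrum (a : nat -> option C) (mu : {measure set R -> \bar R})
  : set C :=
  [set zeta | circ zeta /\
    ((forall e : R, 0 < e -> exists n w, a n = Some w /\ cmod (w - zeta) < e) \/
     (forall e : R, 0 < e ->
        (0 < mu [set t : R | Ico02 t /\ (cmod (ceit t - zeta) < e)%R])%E))].

Definition levelp (psi : C -> C) (delta : R) : set C :=
  [set zeta | circ zeta /\ (ess_norm psi * delta%:E <= (cmod (psi zeta))%:E)%E].

Definition intT (A : set C) : set C :=
  [set zeta | circ zeta /\ exists e : R, 0 < e /\
     forall z, circ z -> cmod (z - zeta) < e -> A z].

End HardyDefs.

(* Main.v *)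
Require Import Defs.
From HB Require Import structures.
From mathcomp Require Import all_boot all_order all_algebra.
From mathcomp Require Import all_classical all_reals all_analysis.
From mathcomp Require Import measurable_realfun.
From mathcomp Require Import complex ring lra.
Import Order.TTheory GRing.Theory Num.Theory.
Import numFieldNormedType.Exports.
Local Open Scope classical_set_scope.
Local Open Scope ring_scope.

(** Suppose [|phi - conj f| <= m < ||phi||] a.e. for some [f] in [H^infty_0], and
    let [J] be an arc around a point [zeta] of the spectrum of [I] on which
    [|Phi| >= D > m].  Since [|phi| = |Phi|] a.e., [Re (f phi) >= D (D - m) > 0]
    a.e. on [J], so the Poisson integral of [f phi = f Phi I] is bounded away from
    0 in the disc near [zeta].  As [f Phi] is a bounded analytic function, so is
    the extension of [I].  Hence no zero of [I] is close to [zeta], and the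
    Poisson integral of the singular measure [mu] is bounded near [zeta]; the
    latter gives [mu (]a, b]) <= C (b - a)] there, which for a singular measure
    forces [mu] to vanish near [zeta].

    Analyticity is given by the vanishing of the negative Fourier coefficients.
    That bounded analytic functions form an algebra reduces to [int f e g = 0]
    with [e = e^{it}]: let [k] be a continuous function close to [f e] in [L^1] and
    [S] the truncated Poisson operator, which is symmetric; then
    [int k g ~ int (S k) g = int k (S g) = int (k - f e) (S g)], because
    [int f e (S g) = 0] term by term. *)

(** * Complex numbers and the unit circle *)

Section ComplexModulus.
Context {R : realType}.
Implicit Types (z w : R[i]) (t : R).
Local Notation cRe := (@complex.Re R).
Local Notation cIm := (@complex.Im R).

Lemma cmodE z : cmod z = ComplexField.Normc.normc z.
Proof. by case: z. Qed.

Lemma cmod_ge0 z : 0 <= cmod z.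
Proof. exact: sqrtr_ge0. Qed.

Lemma cmod0 : cmod (0 : R[i]) = 0.
Proof. by rewrite cmodE ComplexField.Normc.normc0. Qed.

Lemma cmod1 : cmod (1 : R[i]) = 1.
Proof. by rewrite cmodE ComplexField.Normc.normc1. Qed.

Lemma cmod_eq0 z : (cmod z == 0) = (z == 0).
Proof.
apply/eqP/eqP => [|->]; last exact: cmod0.
by rewrite cmodE; exact: ComplexField.Normc.eq0_normc.
Qed.

Lemma cmodM z w : cmod (z * w) = cmod z * cmod w.
Proof. by rewrite !cmodE ComplexField.Normc.normcM. Qed.

Lemma cmodV z : cmod z^-1 = (cmod z)^-1.
Proof. by rewrite !cmodE ComplexField.Normc.normcV. Qed.

Lemma cmodX z n : cmod (z ^+ n) = cmod z ^+ n.
Proof. by elim: n => [|n ih]; rewrite ?cmod1// !exprS cmodM ih. Qed.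

Lemma cmodN z : cmod (- z) = cmod z.
Proof. by rewrite !cmodE normcN. Qed.

Lemma cmodB z w : cmod (z - w) = cmod (w - z).
Proof. by rewrite -cmodN opprB. Qed.

Lemma cmod_conj z : cmod (conjc z) = cmod z.
Proof. by case: z => a b; rewrite /cmod/= sqrrN. Qed.

Lemma ler_cmodD z w : cmod (z + w) <= cmod z + cmod w.
Proof. by rewrite !cmodE le_normcD. Qed.

Lemma ler_cmodDB z w : cmod z - cmod w <= cmod (z + w).
Proof.
by rewrite lerBlDr -{1}(addrK w z) -(cmodN w) ler_cmodD.
Qed.

Lemma sqr_cmod z : cmod z ^+ 2 = cRe z ^+ 2 + cIm z ^+ 2.
Proof. by rewrite sqr_sqrtr// addr_ge0// sqr_ge0. Qed.

Lemma mulcJ z : z * conjc z = Complex (cmod z ^+ 2) 0.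
Proof.
rewrite sqr_cmod; case: z => a b /=.
by apply/eqP; rewrite eq_complex/= !mulrN opprK -!expr2 mulrC addNr !eqxx.
Qed.

Lemma cmod_real (x : R) : cmod (Complex x 0) = `|x|.
Proof. by rewrite /cmod/= expr0n/= addr0 sqrtr_sqr. Qed.

Lemma norm_Re_le_cmod z : `|cRe z| <= cmod z.
Proof. by rewrite -sqrtr_sqr ler_sqrt ?sqr_ge0// ?addr_ge0 ?sqr_ge0// lerDl sqr_ge0. Qed.

Lemma norm_Im_le_cmod z : `|cIm z| <= cmod z.
Proof. by rewrite -sqrtr_sqr ler_sqrt ?sqr_ge0// ?addr_ge0 ?sqr_ge0// lerDr sqr_ge0. Qed.

Lemma cmod_le_normD z : cmod z <= `|cRe z| + `|cIm z|.
Proof.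
rewrite -[leRHS]ger0_norm ?addr_ge0// -sqrtr_sqr ler_sqrt ?sqr_ge0//.
by rewrite sqrrD !real_normK ?num_real// lerD2r lerDl mulrn_wge0// mulr_ge0.
Qed.

Lemma real_complexM (x y : R) : Complex x 0 * Complex y 0 = Complex (x * y) 0 :> R[i].
Proof. by rewrite -[RHS]/(real_complex R (x * y)) rmorphM. Qed.

Lemma real_complexB (x y : R) : Complex x 0 - Complex y 0 = Complex (x - y) 0 :> R[i].
Proof. by rewrite -[RHS]/(real_complex R (x - y)) rmorphB. Qed.

Lemma conjcD z w : conjc (z + w) = conjc z + conjc w.
Proof. exact: rmorphD. Qed.

Lemma conjcB z w : conjc (z - w) = conjc z - conjc w.
Proof. exact: rmorphB. Qed.

Lemma conjcM z w : conjc (z * w) = conjc z * conjc w.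
Proof. exact: rmorphM. Qed.

Lemma conjcX z n : conjc (z ^+ n) = conjc z ^+ n.
Proof. exact: rmorphXn. Qed.

Lemma cReD z w : cRe (z + w) = cRe z + cRe w.
Proof. by case: z w => a b []. Qed.

Lemma cImD z w : cIm (z + w) = cIm z + cIm w.
Proof. by case: z w => a b []. Qed.

Lemma cReM z w : cRe (z * w) = cRe z * cRe w - cIm z * cIm w.
Proof. by case: z w => a b []. Qed.

Lemma cImM z w : cIm (z * w) = cRe z * cIm w + cIm z * cRe w.
Proof. by case: z w => a b []. Qed.

(** * The parametrisation of the circle and its chords *)

Lemma ceitD s t : ceit (s + t) = ceit s * ceit t :> R[i].
Proof.
by apply/eqP; rewrite eq_complex /= cosD sinD eqxx addrC/= addrC eqxx.
Qed.

Lemma ceit0 : ceit 0 = 1 :> R[i].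
Proof. by rewrite /ceit cos0 sin0. Qed.

Lemma cmod_ceit t : cmod (ceit t) = 1.
Proof. by rewrite /cmod/= cos2Dsin2 sqrtr1. Qed.

Lemma ceit_neq0 t : ceit t != 0 :> R[i].
Proof. by rewrite -cmod_eq0 cmod_ceit oner_eq0. Qed.

Lemma conj_ceit t : conjc (ceit t) = (ceit t)^-1 :> R[i].
Proof.
by apply: (mulfI (ceit_neq0 t)); rewrite mulcJ cmod_ceit expr1n divff ?ceit_neq0.
Qed.

Lemma ceitN t : ceit (- t) = (ceit t)^-1 :> R[i].
Proof. by rewrite -conj_ceit /ceit cosN sinN. Qed.

Lemma ceitMn t n : ceit (n%:R * t) = ceit t ^+ n :> R[i].
Proof.
by elim: n => [|n ih]; rewrite ?mul0r ?ceit0// -natr1 mulrDl mul1r ceitD ih exprSr.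
Qed.

Lemma ceit_2pi : ceit (2 * pi) = 1 :> R[i].
Proof. by rewrite mulrC mulr_natr /ceit cos2pi sin2pi. Qed.

Lemma ceit_subr_neq0 z t : disc z -> ceit t - z != 0.
Proof.
move=> zd; rewrite subr_eq0; apply/eqP => e; move: zd.
by rewrite /disc/= -e cmod_ceit ltxx.
Qed.

(** A rotation by $e^{-it}$ reduces the chord to the one from $1$ to $e^{iu}$ with $u = s - t$; the
    half-angle formula then gives its length. *)
Lemma sqr_cmod_ceitB s t :
  cmod (ceit s - ceit t) ^+ 2 = 4 * sin ((s - t) / 2) ^+ 2.
Proof.
rewrite sqr_cmod/=; have -> : s = (s - t) + t by rewrite subrK.
set u := s - t; rewrite addrK cosD sinD.
have := cos2Dsin2 t; set c := cos t; set d := sin t => cd.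
have -> : (cos u * c - sin u * d - c) ^+ 2 + (sin u * c + cos u * d - d) ^+ 2
        = ((cos u - 1) ^+ 2 + sin u ^+ 2) * (c ^+ 2 + d ^+ 2) by ring.
rewrite cd mulr1.
have cu : cos u = 1 - 2 * sin (u / 2) ^+ 2.
  have -> : cos u = cos (u / 2 + u / 2) by congr cos; lra.
  by rewrite cosD -!expr2; have := cos2Dsin2 (u / 2); lra.
by rewrite sin2cos2 cu; ring.
Qed.

Lemma norm_sin_le (u : R) : `|sin u| <= `|u|.
Proof.
wlog u0 : u / 0 <= u.
  move=> W; have [|/ltW] := leP 0 u; first exact: W.
  by rewrite -oppr_ge0 => /W; rewrite sinN !normrN.
rewrite [leRHS]ger0_norm//.
have : forall x : R, x \in `]0, u[ -> is_derive x (1 : R) (@sin R) (cos x).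
  by move=> x _; exact: is_derive_sin.
move=> /(@MVT_segment _ (@sin R) cos 0 u) /=.
case=> [||x _]//; first exact/continuous_subspaceT/continuous_sin.
rewrite sin0 !subr0 => ->; rewrite normrM (ger0_norm u0).
by rewrite ler_piMl// ler_norml cos_geN1 cos_le1.
Qed.

Lemma ceit_lipschitz s t : cmod (ceit s - ceit t) <= `|s - t|.
Proof.
rewrite -(@ler_pXn2r _ 2) ?nnegrE ?cmod_ge0// sqr_cmod_ceitB real_normK ?num_real//.
have : `|sin ((s - t) / 2)| ^+ 2 <= `|(s - t) / 2| ^+ 2.
  by rewrite lerXn2r ?nnegrE ?norm_sin_le.
rewrite !real_normK ?num_real//.
have -> : (s - t) ^+ 2 = 4 * ((s - t) / 2) ^+ 2 by field.
lra.
Qed.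

(** Transfers closeness on the circle to closeness of parameters. The point $t$ has to be interior,
    since $0$ and $2\pi$ name the same point of the circle. *)
Lemma ceit_separated t (d : R) : 0 < t < 2 * pi -> 0 < d -> exists2 e : R, 0 < e &
  forall s, I02 s -> cmod (ceit s - ceit t) < e -> `|s - t| < d.
Proof.
move=> /andP[t0 tpi] d0; have pi0 := @pi_gt0 R.
(* If $|s-t| \ge d$ then $|s-t|/2$ lies in $[m, \pi - m]$, where the sine is at least $\sin m$; so
   the chord is at least $2 \sin m$. *)
pose m := Num.min (d / 2) (Num.min (t / 2) ((2 * pi - t) / 2)).
have m0 : 0 < m by rewrite !lt_min; apply/and3P; split; lra.
have [md mt mpt] : [/\ m <= d / 2, m <= t / 2 & m <= (2 * pi - t) / 2].
  by split; rewrite !ge_min lexx ?orbT.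
have mpi : m < pi by lra.
have sm : 0 < sin m by rewrite sin_gt0_pi// m0 mpi.
exists (2 * sin m) => [|s]; first by rewrite mulr_gt0.
rewrite /I02/= in_itv/= => /andP[s0 spi] slt; rewrite ltNge; apply/negP => dst.
move: slt; apply/negP; rewrite -leNgt.
rewrite -(@ler_pXn2r _ 2) ?nnegrE ?cmod_ge0 ?mulr_ge0 ?(ltW sm)//.
rewrite sqr_cmod_ceitB exprMn.
have -> : sin ((s - t) / 2) ^+ 2 = sin (`|s - t| / 2) ^+ 2.
  by case: (ger0P (s - t)) => // _; rewrite mulNr sinN sqrrN.
have -> : 2 ^+ 2 = 4 :> R by ring.
rewrite ler_pM2l//.
set u := `|s - t| / 2.
have [um ump] : m <= u /\ u <= pi - m.
  split; first by rewrite (le_trans md)// ler_pM2r// invr_gt0.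
  by rewrite /u; case: (ler0P (s - t)) => _; lra.
(* The comparison of sines becomes $|\cos u| \le \cos m$, which follows from monotonicity of the
   cosine on all of $[0,\pi]$. *)
have hs x : sin x ^+ 2 = 1 - cos x ^+ 2 :> R by have := cos2Dsin2 x; lra.
rewrite !hs lerD2l lerN2 -[leLHS]real_normK ?num_real// -[leRHS]real_normK ?num_real//.
rewrite lerXn2r ?nnegrE//.
have cu : cos u <= cos m by rewrite leNgt ltr_cos -?leNgt// in_itv/=; apply/andP; split; lra.
have cu' : cos (pi - m) <= cos u.
  by rewrite leNgt ltr_cos -?leNgt// in_itv/=; apply/andP; split; lra.
rewrite cosB cospi sinpi mul0r addr0 mulN1r in cu'.
by rewrite (le_trans _ (ler_norm _))// ler_norml cu cu'.
Qed.

End ComplexModulus.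

(** * Integration of bounded functions on the circle *)

Section BoundedFunctions.
Context {R : realType}.
Implicit Types (g h : R -> R) (r : R).
Local Notation lam := (@lebesgue_measure R).
Local Notation I02 := (@I02 R).

Lemma aeS (P Q : R -> Prop) : (forall t, P t -> Q t) ->
  {ae lam, forall t, P t} -> {ae lam, forall t, Q t}.
Proof. by move=> PQ; exact: (@filterS _ _ (ae_filter_ringOfSetsType lam)). Qed.

Lemma aeS2 (P P' Q : R -> Prop) : (forall t, P t -> P' t -> Q t) ->
  {ae lam, forall t, P t} -> {ae lam, forall t, P' t} -> {ae lam, forall t, Q t}.
Proof. by move=> PQ; exact: (@filterS2 _ _ (ae_filter_ringOfSetsType lam)). Qed.

Definition rbdd h := measurable_fun I02 h /\
  exists M : R, {ae lam, forall t, I02 t -> `|h t| <= M}.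

Definition aele g h := {ae lam, forall t, I02 t -> g t <= h t}.

Lemma pi2_gt0 : 0 < 2 * pi :> R.
Proof. by rewrite mulr_gt0// pi_gt0. Qed.

Lemma measurable_I02 : measurable I02.
Proof. exact: measurable_itv. Qed.

Lemma lebesgue_I02 : lam I02 = (2 * pi)%:E.
Proof. by rewrite /I02 lebesgue_measure_itv/= lte_fin pi2_gt0 oppr0 adde0. Qed.

Lemma lebesgue_I02_lty : (lam I02 < +oo)%E.
Proof. by rewrite lebesgue_I02 ltry. Qed.

Hint Resolve measurable_I02 lebesgue_I02_lty : core.

Lemma rbdd_cst r : rbdd (cst r).
Proof. by split => //; exists `|r|; apply: aeW. Qed.

Lemma rbddD g h : rbdd g -> rbdd h -> rbdd (fun t => g t + h t).
Proof.
move=> [mg [M gM]] [mh [N hN]]; split; first exact: measurable_funD.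
exists (M + N); apply: aeS2 gM hN => t gM hN tI.
by rewrite (le_trans (ler_normD _ _))// lerD ?gM ?hN.
Qed.

Lemma rbddM g h : rbdd g -> rbdd h -> rbdd (fun t => g t * h t).
Proof.
move=> [mg [M gM]] [mh [N hN]]; split; first exact: measurable_funM.
exists (M * N); apply: aeS2 gM hN => t gM hN tI.
by rewrite normrM ler_pM ?gM ?hN.
Qed.

Lemma rbddN g : rbdd g -> rbdd (fun t => - g t).
Proof.
move=> [mg [M gM]]; split; first exact: measurableT_comp.
by exists M; apply: aeS gM => t gM tI; rewrite normrN gM.
Qed.

Lemma rbddB g h : rbdd g -> rbdd h -> rbdd (fun t => g t - h t).
Proof. by move=> rg rh; apply: rbddD => //; exact: rbddN. Qed.

Lemma rbdd_norm g : rbdd g -> rbdd (fun t => `|g t|).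
Proof.
move=> [mg [M gM]]; split; first exact: measurableT_comp.
by exists M; apply: aeS gM => t gM tI; rewrite normr_id gM.
Qed.

Lemma rbdd_continuous g : continuous g -> rbdd g.
Proof.
move=> cg; split.
  by apply: measurable_funTS; exact: continuous_measurable_fun.
have : compact (g @` I02).
  apply: continuous_compact; last exact: segment_compact.
  exact: continuous_subspaceT.
move=> /compact_bounded[M [_ HM]]; exists (M + 1); apply: aeW => t tI.
by apply: (HM (M + 1)); [rewrite ltrDl|exists t].
Qed.

Lemma rbdd_integrable g : rbdd g -> lam.-integrable I02 (EFin \o g).
Proof.
move=> [mg [M gM]]; apply/integrableP; split; first exact/measurable_EFinP.
apply: (@le_lt_trans _ _ (`|M|%:E * lam I02)%E).
  apply: integral_le_bound => //; first exact/measurable_EFinP.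
  apply: aeS gM => t gM tI; rewrite /= lee_fin.
  by rewrite (le_trans (gM tI))// ler_norm.
by rewrite lebesgue_I02 -EFinM ltry.
Qed.

Lemma RintD g h : rbdd g -> rbdd h ->
  Rintegral lam I02 (fun t => g t + h t) = Rintegral lam I02 g + Rintegral lam I02 h.
Proof. by move=> rg rh; rewrite RintegralD//; exact: rbdd_integrable. Qed.

Lemma RintZ r g : rbdd g ->
  Rintegral lam I02 (fun t => r * g t) = r * Rintegral lam I02 g.
Proof. by move=> rg; rewrite RintegralZl//; exact: rbdd_integrable. Qed.

Lemma RintB g h : rbdd g -> rbdd h ->
  Rintegral lam I02 (fun t => g t - h t) = Rintegral lam I02 g - Rintegral lam I02 h.
Proof. by move=> rg rh; rewrite RintegralB//; exact: rbdd_integrable. Qed.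

Lemma Rint_cst r : Rintegral lam I02 (cst r) = r * (2 * pi).
Proof.
rewrite [LHS](@Rintegral_cst _ _ _ lam I02 measurable_I02 r).
exact: (congr1 (fun x => r * fine x) lebesgue_I02).
Qed.

Lemma Rint_ae_eq g h : rbdd g -> rbdd h ->
  {ae lam, forall t, I02 t -> g t = h t} ->
  Rintegral lam I02 g = Rintegral lam I02 h.
Proof.
move=> [mg _] [mh _] gh; congr fine; apply: ae_eq_integral => //.
- exact/measurable_EFinP.
- exact/measurable_EFinP.
- by apply: aeS gh => t gh tI; rewrite gh.
Qed.

(** Reduces to the nonnegativity of the integral of [|h - g|], a function that is nonnegative
    everywhere and agrees a.e. with [h - g]. *)
Lemma ae_le_Rint g h : rbdd g -> rbdd h -> aele g h ->
  Rintegral lam I02 g <= Rintegral lam I02 h.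
Proof.
move=> rg rh gh; rewrite -subr_ge0 -RintB//.
have rB : rbdd (fun t => h t - g t) by exact: rbddB.
rewrite (_ : Rintegral _ _ _ = Rintegral lam I02 (fun t => `|h t - g t|)).
  exact: Rintegral_ge0.
apply: Rint_ae_eq => //; first exact: rbdd_norm.
by apply: aeS gh => t gh tI; rewrite ger0_norm// subr_ge0 gh.
Qed.

Lemma le_norm_Rint g : rbdd g ->
  `|Rintegral lam I02 g| <= Rintegral lam I02 (fun t => `|g t|).
Proof. by move=> rg; apply: le_normr_Rintegral => //; exact: rbdd_integrable. Qed.

Lemma Rint_dominated (u : nat -> R -> R) g (M : R) : (forall n, rbdd (u n)) -> rbdd g ->
  (forall n, {ae lam, forall t, I02 t -> `|u n t| <= M}) ->
  {ae lam, forall t, I02 t -> u ^~ t @ \oo --> g t} ->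
  Rintegral lam I02 (fun t => `|u n t - g t|) @[n --> \oo] --> 0.
Proof.
move=> ru rg uM ug.
have [] := @dominated_convergence _ _ _ lam I02 measurable_I02
   (fun n => EFin \o u n) (EFin \o g) (cst M%:E).
- by move=> n; apply/measurable_EFinP; case: (ru n).
- by apply/measurable_EFinP; case: rg.
- by apply: aeS ug => t ug tI; apply: cvg_EFin; [exact: nearW|exact: ug].
- exact: (rbdd_integrable _ (rbdd_cst M)).
- have := @ae_foralln _ _ _ lam (fun n t => I02 t -> `|u n t| <= M) uM.
  by apply: aeS => t H n tI; rewrite /= lee_fin H.
move=> _ H _; move/fine_cvgP: H => [_]; exact.
Qed.

End BoundedFunctions.
#[global] Hint Resolve measurable_I02 lebesgue_I02_lty : core.

(** * Complex-valued integrals and orthogonality of the exponentials *)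

Section ComplexIntegrals.
Context {R : realType}.
Implicit Types (f g h : R -> R[i]) (c z : R[i]).
Local Notation lam := (@lebesgue_measure R).
Local Notation I02 := (@I02 R).
Local Notation cRe := (@complex.Re R).
Local Notation cIm := (@complex.Im R).
Local Notation cI := (cint lam I02).

Definition cbdd g := rbdd (fun t => cRe (g t)) /\ rbdd (fun t => cIm (g t)).

Definition aebd g M := {ae lam, forall t, I02 t -> cmod (g t) <= M}.

Lemma aebd_Re g M : aebd g M -> {ae lam, forall t, I02 t -> `|cRe (g t)| <= M}.
Proof. by apply: aeS => t H /H; apply: le_trans; exact: norm_Re_le_cmod. Qed.

Lemma aebd_Im g M : aebd g M -> {ae lam, forall t, I02 t -> `|cIm (g t)| <= M}.
Proof. by apply: aeS => t H /H; apply: le_trans; exact: norm_Im_le_cmod. Qed.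

Lemma cbddP g : cbdd g <->
  [/\ measurable_fun I02 (fun t => cRe (g t)),
      measurable_fun I02 (fun t => cIm (g t)) & exists M, aebd g M].
Proof.
split=> [[[mR [M gM]] [mI [N gN]]]|[mR mI [M gM]]].
  split=> //; exists (M + N); apply: aeS2 gM gN => t gM gN tI.
  by rewrite (le_trans (cmod_le_normD _))// lerD ?gM ?gN.
by split; split=> //; exists M; [exact: aebd_Re|exact: aebd_Im].
Qed.

Lemma cbddD f g : cbdd f -> cbdd g -> cbdd (fun t => f t + g t).
Proof.
move=> [fR fI] [gR gI]; split.
  by under eq_fun do rewrite cReD; exact: rbddD.
by under eq_fun do rewrite cImD; exact: rbddD.
Qed.

Lemma cbddM f g : cbdd f -> cbdd g -> cbdd (fun t => f t * g t).
Proof.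
move=> [fR fI] [gR gI]; split.
  by under eq_fun do rewrite cReM; apply: rbddB; exact: rbddM.
by under eq_fun do rewrite cImM; apply: rbddD; exact: rbddM.
Qed.

Lemma cbdd_cst c : cbdd (fun=> c).
Proof. by split; exact: rbdd_cst. Qed.

Lemma cbddN f : cbdd f -> cbdd (fun t => - f t).
Proof.
move=> cf; under eq_fun do rewrite -mulN1r; apply: cbddM => //; exact: cbdd_cst.
Qed.

Lemma cbddB f g : cbdd f -> cbdd g -> cbdd (fun t => f t - g t).
Proof. by move=> cf cg; apply: cbddD => //; exact: cbddN. Qed.

Lemma cbddX f n : cbdd f -> cbdd (fun t => f t ^+ n).
Proof.
move=> cf; elim: n => [|n ih].
  by under eq_fun do rewrite expr0; exact: cbdd_cst.
by under eq_fun do rewrite exprS; exact: cbddM.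
Qed.

Lemma cbdd_sum (u : nat -> R -> R[i]) N : (forall n, cbdd (u n)) ->
  cbdd (fun t => \sum_(n < N) u n t).
Proof.
move=> cu; elim: N => [|N ih].
  by under eq_fun do rewrite big_ord0; exact: cbdd_cst.
by under eq_fun do rewrite big_ord_recr/=; exact: cbddD.
Qed.

Lemma cbdd_conj f : cbdd f -> cbdd (fun t => conjc (f t)).
Proof.
move=> [fR fI]; split.
  by rewrite (_ : (fun t => _) = (fun t => cRe (f t)))//; apply: funext => t; case: (f t).
rewrite (_ : (fun t => _) = (fun t => - cIm (f t))); first exact: rbddN.
by apply: funext => t; case: (f t).
Qed.

Lemma cbdd_ceit : cbdd (@ceit R).
Proof.
by split; apply: rbdd_continuous; [exact: continuous_cos|exact: continuous_sin].
Qed.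

Lemma cbdd_ceitV : cbdd (fun t => (@ceit R t)^-1).
Proof. by under eq_fun do rewrite -conj_ceit; exact/cbdd_conj/cbdd_ceit. Qed.

Lemma cID f g : cbdd f -> cbdd g -> cI (fun t => f t + g t) = cI f + cI g.
Proof.
move=> [fR fI] [gR gI]; apply/eqP; rewrite eq_complex/=.
under eq_Rintegral do rewrite cReD.
under [in X in _ && X]eq_Rintegral do rewrite cImD.
by rewrite !RintD ?eqxx.
Qed.

Lemma cIZ c f : cbdd f -> cI (fun t => c * f t) = c * cI f.
Proof.
move=> [fR fI]; apply/eqP; rewrite eq_complex; case: c => a b/=.
under eq_Rintegral do rewrite cReM/=.
under [in X in _ && X]eq_Rintegral do rewrite cImM/=.
rewrite RintB ?RintD//; try by apply: rbddM => //; exact: rbdd_cst.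
by rewrite !RintZ ?eqxx.
Qed.

Lemma cI_cst c : cI (fun=> c) = c * Complex (2 * pi) 0.
Proof.
apply/eqP; rewrite eq_complex/= !Rint_cst; case: c => a b /=.
by rewrite !mulr0 subr0 add0r !eqxx.
Qed.

Lemma cIN f : cbdd f -> cI (fun t => - f t) = - cI f.
Proof. by move=> cf; under eq_fun do rewrite -mulN1r; rewrite cIZ// mulN1r. Qed.

Lemma cIB f g : cbdd f -> cbdd g -> cI (fun t => f t - g t) = cI f - cI g.
Proof. by move=> cf cg; rewrite cID// ?cIN//; exact: cbddN. Qed.

Lemma cI_sum (u : nat -> R -> R[i]) N : (forall n, cbdd (u n)) ->
  cI (fun t => \sum_(n < N) u n t) = \sum_(n < N) cI (u n).
Proof.
move=> cu; elim: N => [|N ih].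
  under eq_fun do rewrite big_ord0.
  by rewrite big_ord0 cI_cst mul0r.
under eq_fun do rewrite big_ord_recr/=.
by rewrite cID ?ih ?big_ord_recr//; exact: cbdd_sum.
Qed.

Lemma cI_conj f : cbdd f -> cI (fun t => conjc (f t)) = conjc (cI f).
Proof.
move=> [fR fI]; apply/eqP; rewrite eq_complex/=; apply/andP; split; apply/eqP.
  by apply: eq_Rintegral => t _; case: (f t).
rewrite -mulN1r -RintZ//; apply: eq_Rintegral => t _; case: (f t) => a b /=.
by rewrite mulN1r.
Qed.

(** Equivalent to the usual $L^1$ norm; the split into real and imaginary parts matches the way
    [cint] is built from real integrals. *)
Definition L1 f := Rintegral lam I02 (fun t => `|cRe (f t)|) +
                   Rintegral lam I02 (fun t => `|cIm (f t)|).

(** The factor 2 comes from estimating the real and the imaginary part of the integral separately,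
    each by the integral of [q]. *)
Lemma cmod_cI_le_Rint f (q : R -> R) : cbdd f -> rbdd q ->
  aele (fun t => cmod (f t)) q -> cmod (cI f) <= 2 * Rintegral lam I02 q.
Proof.
move=> [fR fI] rq fq; rewrite (le_trans (cmod_le_normD _))//= mulr_natl mulr2n.
have key (h : R -> R) : rbdd h -> (forall t, `|h t| <= cmod (f t)) ->
    `|Rintegral lam I02 h| <= Rintegral lam I02 q.
  move=> rh hf; rewrite (le_trans (le_norm_Rint _ rh))//.
  apply: ae_le_Rint => //; first exact: rbdd_norm.
  by apply: aeS fq => t fq tI; rewrite (le_trans (hf t))// fq.
apply: lerD; apply: key => // t; [exact: norm_Re_le_cmod|exact: norm_Im_le_cmod].
Qed.

Lemma cmod_cI_le f g M : cbdd f -> cbdd g -> aebd g M ->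
  cmod (cI (fun t => f t * g t)) <= 2 * (M * L1 f).
Proof.
move=> cf cg gM; have [fR fI] := cf.
have [nR nI] := (rbdd_norm _ fR, rbdd_norm _ fI).
rewrite /L1 -RintD// -RintZ; last exact: rbddD.
apply: cmod_cI_le_Rint; first exact: cbddM.
  by apply: rbddM; [exact: rbdd_cst|exact: rbddD].
apply: aeS gM => t gM tI; rewrite cmodM mulrC.
by rewrite ler_pM ?cmod_ge0 ?gM// cmod_le_normD.
Qed.

Lemma cmod_cI_bound g M : cbdd g -> aebd g M -> cmod (cI g) <= 2 * (M * (2 * pi)).
Proof.
move=> cg gM.
by rewrite -Rint_cst; apply: cmod_cI_le_Rint => //; exact: rbdd_cst.
Qed.

Lemma cI_ceitX n : (0 < n)%N -> cI (fun t => ceit t ^+ n) = 0.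
Proof.
move=> n0; under eq_fun do rewrite -ceitMn.
have n0' : n%:R != 0 :> R by rewrite pnatr_eq0 -lt0n.
have FTC (F f : R -> R) : (forall x, is_derive x (1 : R) F (f x)) -> continuous f ->
    F (2 * pi) = F 0 -> Rintegral lam I02 f = 0.
  move=> dF cf F0; rewrite /Rintegral /I02 (@continuous_FTC2 _ f F)//.
  - by rewrite F0 subee.
  - exact: pi2_gt0.
  - exact: continuous_subspaceT.
  - have cF : continuous F.
      by move=> x; apply: differentiable_continuous; apply/derivable1_diffP; case: (dF x).
    split; first by move=> x _; case: (dF x).
    + exact/cvg_at_right_filter/cF.
    + exact/cvg_at_left_filter/cF.
  - by move=> x _; rewrite derive1E; apply: derive_val.
(* By periodicity the primitives of $\cos nt$ and $\sin nt$ take equal values at both endpoints. *)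
have en : ceit (n%:R * (2 * pi)) = 1 :> R[i] by rewrite ceitMn ceit_2pi expr1n.
apply/eqP; rewrite eq_complex/=; apply/andP; split; apply/eqP.
- apply: (FTC (fun t => n%:R^-1 * sin (n%:R * t))).
  + move=> x; apply: is_derive_eq.
    by rewrite /= !scaler1 ?scaler0 ?addr0; rewrite /GRing.scale/=; field.
  + by move=> x; apply: continuous_comp; [exact: mulrl_continuous|exact: continuous_cos].
  + by case: en => _ ->; rewrite !mulr0 sin0 mulr0.
- apply: (FTC (fun t => - n%:R^-1 * cos (n%:R * t))).
  + move=> x; apply: is_derive_eq.
    by rewrite /= !scaler1 ?scaler0 ?addr0; rewrite /GRing.scale/=; field.
  + by move=> x; apply: continuous_comp; [exact: mulrl_continuous|exact: continuous_sin].
  + by case: en => -> _; rewrite !mulr0 cos0.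
Qed.

Lemma cI_ceitVX n : (0 < n)%N -> cI (fun t => (ceit t)^-1 ^+ n) = 0.
Proof.
move=> n0; under eq_fun do rewrite -conj_ceit -conjcX.
by rewrite cI_conj ?cI_ceitX ?conjc0//; exact/cbddX/cbdd_ceit.
Qed.

End ComplexIntegrals.

(** * The Cauchy and Poisson kernels *)

Section Kernels.
Context {R : realType}.
Implicit Types (f g h : R -> R[i]) (c z w zeta : R[i]) (s t : R).
Local Notation lam := (@lebesgue_measure R).
Local Notation cRe := (@complex.Re R).
Local Notation cIm := (@complex.Im R).
Local Notation I02 := (@I02 R).
Local Notation cI := (cint lam I02).

(** The Cauchy kernel $\sum_{n\ge0} z^n e^{-int}$ for $z$ in the disc. *)
Definition cauchyk z t : R[i] := ceit t / (ceit t - z).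

(** The Poisson kernel without the factor $1/2\pi$: its total mass over the circle is $2\pi$. *)
Definition pois z t : R := (1 - cmod z ^+ 2) / cmod (ceit t - z) ^+ 2.

Lemma cmod_ceitB_ge z t : 1 - cmod z <= cmod (ceit t - z).
Proof. by rewrite -(cmod_ceit t) -(cmodN z) ler_cmodDB. Qed.

Lemma cmod_ceitB_gt0 z t : disc z -> 0 < cmod (ceit t - z).
Proof. by move=> zd; rewrite (lt_le_trans _ (cmod_ceitB_ge z t))// subr_gt0. Qed.

Lemma continuous_cmod_ceitB z : continuous (fun t => cmod (ceit t - z) ^+ 2).
Proof.
have -> : (fun t => cmod (ceit t - z) ^+ 2) =
    (fun t => (cos t - cRe z) * (cos t - cRe z) + (sin t - cIm z) * (sin t - cIm z)).
  by apply: funext => t; rewrite sqr_cmod; case: z => a b /=; rewrite !expr2.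
move=> t; apply: cvgD; apply: cvgM.
- by apply: cvgB; [exact: continuous_cos|exact: cvg_cst].
- by apply: cvgB; [exact: continuous_cos|exact: cvg_cst].
- by apply: cvgB; [exact: continuous_sin|exact: cvg_cst].
- by apply: cvgB; [exact: continuous_sin|exact: cvg_cst].
Qed.

Lemma continuous_cmod_ceitBV z : disc z ->
  continuous (fun t => (cmod (ceit t - z) ^+ 2)^-1).
Proof.
move=> zd t; apply: cvgV; last exact: continuous_cmod_ceitB.
by rewrite gt_eqF// exprn_gt0// cmod_ceitB_gt0.
Qed.

Lemma continuous_pois z : disc z -> continuous (pois z).
Proof.
by move=> zd t; apply: cvgM; [exact: cvg_cst|exact: continuous_cmod_ceitBV].
Qed.

Lemma rbdd_pois z : disc z -> rbdd (pois z).
Proof. by move=> zd; exact/rbdd_continuous/continuous_pois. Qed.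

(** Uses $1/w = \bar w/|w|^2$, where the real factor $1/|w|^2$ is continuous in $t$. *)
Lemma cbdd_ceitBV z : disc z -> cbdd (fun t => (ceit t - z)^-1).
Proof.
move=> zd.
have -> : (fun t => (ceit t - z)^-1) =
    (fun t => Complex ((cmod (ceit t - z) ^+ 2)^-1) 0 * conjc (ceit t - z)).
  apply: funext => t; have e0 := ceit_subr_neq0 _ t zd.
  apply: (mulfI e0); rewrite divff// mulrCA mulcJ.
  have := cmod_ceitB_gt0 _ t zd; set x := cmod _ => x0.
  apply/esym/eqP; rewrite eq_complex/= !mulr0 !mul0r addr0 subr0 eqxx andbT.
  by rewrite mulVf// expf_neq0// gt_eqF.
apply: cbddM; last by apply/cbdd_conj/cbddB; [exact: cbdd_ceit|exact: cbdd_cst].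
split; last exact: rbdd_cst.
exact/rbdd_continuous/continuous_cmod_ceitBV.
Qed.

Lemma cbdd_cauchyk z : disc z -> cbdd (cauchyk z).
Proof. by move=> zd; apply: cbddM; [exact: cbdd_ceit|exact: cbdd_ceitBV]. Qed.

Lemma cmod_cauchyk_le z t : disc z -> cmod (cauchyk z t) <= (1 - cmod z)^-1.
Proof.
move=> zd; rewrite cmodM cmod_ceit mul1r cmodV lef_pV2 ?posrE ?cmod_ceitB_gt0//.
  exact: cmod_ceitB_ge.
by rewrite subr_gt0.
Qed.

(** One step of the geometric expansion. Iterating it with an explicit remainder avoids exchanging
    an infinite sum with an integral. *)
Lemma cauchyk_rec z t : disc z -> cauchyk z t = 1 + z * ((ceit t)^-1 * cauchyk z t).
Proof.
move=> zd; rewrite /cauchyk; have := ceit_subr_neq0 _ t zd; have := ceit_neq0 t.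
by move: (ceit t) => e e0 ez0; field; rewrite ez0 e0.
Qed.

Lemma cauchyk_shift z t : disc z -> ceit t * cauchyk z t = ceit t + z * cauchyk z t.
Proof.
move=> zd; rewrite /cauchyk; have := ceit_subr_neq0 _ t zd.
by move: (ceit t) => e ez0; field.
Qed.

Lemma geometric_cvg_le (x : R[i]) (q B : R) : 0 <= q < 1 ->
  (forall n, cmod x <= q ^+ n * B) -> x = 0.
Proof.
move=> /andP[q0 q1] H; apply/eqP; rewrite -cmod_eq0 eq_le cmod_ge0 andbT.
have : (fun n => q ^+ n * B) @ \oo --> 0 * B.
  apply: cvgM; last exact: cvg_cst.
  by apply: cvg_expr; rewrite ger0_norm.
rewrite mul0r => C; rewrite -(cvg_lim (@Rhausdorff R) C).
by apply: limr_ge; [apply/cvg_ex; exists 0|exact: nearW].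
Qed.

(** Each application of [cauchyk_rec] splits off a vanishing coefficient and a factor $z$. The
    integral is therefore $z^n$ times a quantity bounded uniformly in $n$, for every $n$, hence
    zero. *)
Lemma cI_cauchyk_eq0 g z : disc z -> cbdd g ->
  (forall n, cI (fun t => g t * (ceit t)^-1 ^+ n) = 0) ->
  cI (fun t => g t * cauchyk z t) = 0.
Proof.
move=> zd cg g0; have cV := @cbdd_ceitV R; have cK := cbdd_cauchyk _ zd.
pose u n := fun t => g t * (ceit t)^-1 ^+ n * cauchyk z t.
have cu n : cbdd (u n) by apply/cbddM => //; apply/cbddM => //; exact: cbddX.
have rec n : cI (u n) = z * cI (u n.+1).
  have -> : u n = fun t => g t * (ceit t)^-1 ^+ n + z * u n.+1 t.
    apply: funext => t; rewrite /u {1}cauchyk_rec// exprSr; ring.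
  rewrite cID ?cIZ ?g0 ?add0r//; first by apply: cbddM => //; exact: cbddX.
  by apply: cbddM => //; exact: cbdd_cst.
have u0 n : cI (u 0) = z ^+ n * cI (u n).
  elim: n => [|n ->]; first by rewrite expr0 mul1r.
  by rewrite rec exprSr mulrA.
have -> : (fun t => g t * cauchyk z t) = u 0.
  by apply: funext => t; rewrite /u expr0 mulr1.
have [_ _ [M gM]] := (cbddP g).1 cg.
apply: (@geometric_cvg_le _ (cmod z) (2 * (M * (1 - cmod z)^-1 * (2 * pi)))).
  by rewrite cmod_ge0.
move=> n; rewrite (u0 n) cmodM cmodX ler_wpM2l ?exprn_ge0 ?cmod_ge0//.
apply: cmod_cI_bound => //; apply: aeS gM => t gM tI.
rewrite cmodM cmodM cmodX cmodV cmod_ceit invr1 expr1n mulr1.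
by rewrite ler_pM ?cmod_ge0 ?gM ?cmod_cauchyk_le.
Qed.

Lemma cI_conj_cauchyk_eq0 g z : disc z -> cbdd g ->
  (forall n, cI (fun t => g t * ceit t ^+ n) = 0) ->
  cI (fun t => g t * conjc (cauchyk z t)) = 0.
Proof.
move=> zd cg g0; rewrite -[LHS](conjcK) -cI_conj; last first.
  by apply: cbddM => //; exact/cbdd_conj/cbdd_cauchyk.
apply/eqP; rewrite conjc_eq0; apply/eqP.
under eq_fun do rewrite conjcM conjcK.
apply: (cI_cauchyk_eq0 (fun t => conjc (g t)) z zd (cbdd_conj _ cg)) => n.
have := congr1 conjc (g0 n); rewrite conjc0 -cI_conj.
  by under eq_fun do rewrite conjcM conjcX conj_ceit.
by apply: cbddM => //; exact/cbddX/cbdd_ceit.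
Qed.

Lemma cI_cauchyk z : disc z -> cI (cauchyk z) = Complex (2 * pi) 0.
Proof.
move=> zd; have -> : cauchyk z = fun t => 1 + z * ((ceit t)^-1 * cauchyk z t).
  by apply: funext => t; exact: cauchyk_rec.
have cK : cbdd (fun t => (ceit t)^-1 * cauchyk z t).
  by apply: cbddM; [exact: cbdd_ceitV|exact: cbdd_cauchyk].
rewrite cID ?cIZ// ?cI_cst ?mul1r; last 2 first.
- exact: cbdd_cst.
- by apply: cbddM => //; exact: cbdd_cst.
rewrite cI_cauchyk_eq0 ?mulr0 ?addr0//; first exact: cbdd_ceitV.
by move=> n; under eq_fun do rewrite -exprS; exact: cI_ceitVX.
Qed.

Lemma pois_ge0 z t : disc z -> 0 <= pois z t.
Proof.
move=> zd; rewrite divr_ge0 ?exprn_ge0 ?cmod_ge0// subr_ge0.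
by rewrite expr_le1// ?cmod_ge0// ltW.
Qed.

Lemma conj_cauchyk z t : conjc (cauchyk z t) = (1 - conjc z * ceit t)^-1.
Proof.
rewrite /cauchyk conjcM conjc_inv conjcB conj_ceit.
rewrite -invfM mulrBr divff ?ceit_neq0// [ceit t * _]mulrC //.
Qed.

Lemma conj_disc z : disc z -> disc (conjc z).
Proof. by rewrite /disc/= cmod_conj. Qed.

Lemma one_sub_conjM_neq0 z t : disc z -> 1 - conjc z * ceit t != 0.
Proof.
move=> zd; have := ceit_subr_neq0 _ (- t) (conj_disc _ zd).
apply: contra => /eqP e; rewrite ceitN subr_eq0; apply/eqP.
apply: (mulIf (ceit_neq0 t)); rewrite mulVf ?ceit_neq0//.
by apply/eqP; rewrite -subr_eq0 e.
Qed.

(** Links the Poisson kernel to the Cauchy kernel $K$ as $P = K + \bar K - 1$: the two one-sided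
    geometric series share their constant term, which is subtracted once. *)
Lemma complex_pois z t : disc z ->
  Complex (pois z t) 0 = cauchyk z t + conjc (cauchyk z t) - 1.
Proof.
move=> zd; have e0 := ceit_neq0 t; have ez := ceit_subr_neq0 _ t zd.
have := cmod_ceitB_gt0 _ t zd => x0.
have := mulcJ (ceit t - z); rewrite conjcB conj_ceit => E.
have h : Complex (cmod (ceit t - z) ^+ 2) 0 != 0.
  by rewrite eq_complex/= eqxx andbT expf_neq0// gt_eqF.
apply: (mulfI h); transitivity (1 - z * conjc z).
  rewrite mulcJ real_complexM -[1]/(Complex 1 0) real_complexB; congr Complex.
  by rewrite /pois mulrCA divff ?mulr1// expf_neq0// gt_eqF.
rewrite conj_cauchyk /cauchyk -E; have := one_sub_conjM_neq0 _ t zd.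
(* With $\bar z$ generalised to an independent variable the claim is an identity of rational
   functions. *)
move: (ceit t) (conjc z) e0 ez => e zz e0 ez ez'.
by field; rewrite ez ez' e0.
Qed.

(** Since $|e^{it}-z|^2 = (e^{it}-z)\overline{(e^{it}-z)}$, a factor $e^{it}-z$ cancels and leaves a
    conjugate Cauchy kernel, to which [cI_conj_cauchyk_eq0] applies. *)
Lemma ceitB_pois z t : disc z -> (ceit t - z) * Complex (pois z t) 0 =
  Complex (1 - cmod z ^+ 2) 0 * (ceit t * conjc (cauchyk z t)).
Proof.
move=> zd; have e0 := ceit_neq0 t; have ez := ceit_subr_neq0 _ t zd.
have -> : Complex (1 - cmod z ^+ 2) 0 = 1 - z * conjc z.
  by rewrite mulcJ; apply/eqP; rewrite eq_complex/= subr0 !eqxx.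
rewrite complex_pois// conj_cauchyk /cauchyk; have := one_sub_conjM_neq0 _ t zd.
move: (ceit t) (conjc z) e0 ez => e zz e0 ez ez'.
by field; rewrite ez ez'.
Qed.

Lemma Re_herglotz z t : disc z -> cRe ((ceit t + z) / (ceit t - z)) = pois z t.
Proof.
move=> zd; have ez := ceit_subr_neq0 _ t zd.
have -> : (ceit t + z) / (ceit t - z) = cauchyk z t + cauchyk z t - 1.
  by rewrite /cauchyk; move: (ceit t) ez => e ez; field.
have := congr1 cRe (complex_pois _ t zd) => /= ->.
by rewrite !cReD; case: (cauchyk z t) => a b /=.
Qed.

Lemma cbdd_pois z : disc z -> cbdd (fun t => Complex (pois z t) 0).
Proof. by move=> zd; split; [exact: rbdd_pois|exact: rbdd_cst]. Qed.

Lemma cI_pois z : disc z -> cI (fun t => Complex (pois z t) 0) = Complex (2 * pi) 0.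
Proof.
move=> zd; have cK := cbdd_cauchyk _ zd; have cK' := cbdd_conj _ cK.
under eq_fun do rewrite complex_pois//.
rewrite cIB ?cID ?cI_cst ?cI_conj ?cI_cauchyk ?mul1r//; last 2 first.
- exact: cbddD.
- exact: cbdd_cst.
by apply/eqP; rewrite eq_complex/= addrK oppr0 !addr0 !eqxx.
Qed.

Lemma Rint_pois z : disc z -> Rintegral lam I02 (pois z) = 2 * pi.
Proof. by move=> /cI_pois[]. Qed.

(** The numerator is at most $2|z-\zeta|$ because $|\zeta|=1$, and the distance from $e^{it}$ to $z$
    is at least $e/2$. *)
Lemma pois_le_away z zeta (e : R) t : 0 < e -> cmod zeta = 1 -> disc z ->
  cmod (z - zeta) <= e / 2 -> e <= cmod (ceit t - zeta) ->
  pois z t <= 8 * cmod (z - zeta) / e ^+ 2.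
Proof.
move=> e0 zeta1 zd zz tz.
have h : e / 2 <= cmod (ceit t - z).
  have := ler_cmodDB (ceit t - zeta) (zeta - z).
  rewrite addrA subrK (cmodB zeta) => H; apply: le_trans H; lra.
have z1 : 1 - cmod z <= cmod (z - zeta).
  rewrite -zeta1 lerBlDr; have := ler_cmodD (zeta - z) z.
  by rewrite subrK (cmodB zeta).
have zge := cmod_ge0 z.
have z2 : 1 - cmod z ^+ 2 <= 2 * cmod (z - zeta).
  have -> : 1 - cmod z ^+ 2 = (1 - cmod z) * (1 + cmod z) by ring.
  rewrite [leRHS]mulrC ler_pM ?subr_ge0 ?addr_ge0//; first exact: ltW.
  by rewrite -[2]/(1 + 1) lerD2l ltW.
rewrite /pois; have -> : 8 * cmod (z - zeta) / e ^+ 2 =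
    (2 * cmod (z - zeta)) / (e / 2) ^+ 2 by field; rewrite gt_eqF.
apply: ler_pM => //.
- by rewrite subr_ge0 expr_le1// ltW.
- by rewrite invr_ge0 exprn_ge0// cmod_ge0.
- rewrite lef_pV2 ?posrE ?exprn_gt0 ?divr_gt0// ?cmod_ceitB_gt0//.
  by rewrite lerXn2r ?nnegrE ?cmod_ge0// divr_ge0// ltW.
Qed.

End Kernels.

(** * The truncated Poisson operator *)

Section TruncatedPoisson.
Context {R : realType}.
Implicit Types (f g h k : R -> R[i]) (c z w zeta : R[i]) (r s t : R).
Local Notation lam := (@lebesgue_measure R).
Local Notation cRe := (@complex.Re R).
Local Notation cIm := (@complex.Im R).
Local Notation I02 := (@I02 R).
Local Notation cI := (cint lam I02).

Local Opaque cint.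

(** Partial sum of $\sum_{n\in\mathbb Z} r^{|n|} e^{in(t-s)}$, the Poisson kernel at $re^{it}$. The
    final $-1$ corrects the term $n=0$, which the sum counts twice. *)
Definition tpois r N t s : R[i] :=
  \sum_(n < N) Complex (r ^+ n) 0 *
    (ceit t ^+ n * (ceit s)^-1 ^+ n + (ceit t)^-1 ^+ n * ceit s ^+ n) - 1.

(** The integral of [g] against [tpois], written term by term through the Fourier coefficients of
    [g]. Like [pois] it is not normalised, so it approximates $2\pi g$. *)
Definition tpoisI r N g t : R[i] :=
  \sum_(n < N) Complex (r ^+ n) 0 *
    (ceit t ^+ n * cI (fun s => g s * (ceit s)^-1 ^+ n) +
     (ceit t)^-1 ^+ n * cI (fun s => g s * ceit s ^+ n)) - cI g.

Lemma cbdd_mul_ceitX g n : cbdd g -> cbdd (fun s => g s * ceit s ^+ n).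
Proof. by move=> cg; apply: (cbddM _ _ cg); exact/cbddX/cbdd_ceit. Qed.

Lemma cbdd_mul_ceitVX g n : cbdd g -> cbdd (fun s => g s * (ceit s)^-1 ^+ n).
Proof. by move=> cg; apply: (cbddM _ _ cg); exact/cbddX/cbdd_ceitV. Qed.

Lemma cbddZ c g : cbdd g -> cbdd (fun s => c * g s).
Proof. by move=> cg; apply: cbddM => //; exact: cbdd_cst. Qed.

Lemma cI_lincomb (a b c : R[i]) f g : cbdd f -> cbdd g ->
  cI (fun t => c * (a * f t + b * g t)) = c * (a * cI f + b * cI g).
Proof.
move=> cf cg; have [caf cbg] := (cbddZ a f cf, cbddZ b g cg).
by rewrite (cIZ c _ (cbddD _ _ caf cbg)) (cID _ _ caf cbg) (cIZ a _ cf) (cIZ b _ cg).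
Qed.

Lemma cbdd_tpois r N t : cbdd (tpois r N t).
Proof.
apply: cbddB; last exact: cbdd_cst.
apply: (cbdd_sum (fun n s => Complex (r ^+ n) 0 *
    (ceit t ^+ n * (ceit s)^-1 ^+ n + (ceit t)^-1 ^+ n * ceit s ^+ n))) => n.
apply/cbddZ/cbddD; apply: cbddZ; apply: cbddX; first exact: cbdd_ceitV.
exact: cbdd_ceit.
Qed.

Lemma cbdd_tpoisI r N g : cbdd (tpoisI r N g).
Proof.
apply: cbddB; last exact: cbdd_cst.
apply: (cbdd_sum (fun n s => Complex (r ^+ n) 0 *
    (ceit s ^+ n * cI (fun s => g s * (ceit s)^-1 ^+ n) +
     (ceit s)^-1 ^+ n * cI (fun s => g s * ceit s ^+ n)))) => n.
apply/cbddZ/cbddD; (apply: cbddM; last exact: cbdd_cst); apply: cbddX.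
  exact: cbdd_ceit.
exact: cbdd_ceitV.
Qed.

Lemma tpoisIE r N g t : cbdd g ->
  tpoisI r N g t = cI (fun s => g s * tpois r N t s).
Proof.
move=> cg.
pose u n s : R[i] := Complex (r ^+ n) 0 *
  (ceit t ^+ n * (g s * (ceit s)^-1 ^+ n) + (ceit t)^-1 ^+ n * (g s * ceit s ^+ n)).
have cu n : cbdd (u n).
  by apply/cbddZ/cbddD; apply: cbddZ; [exact: cbdd_mul_ceitVX|exact: cbdd_mul_ceitX].
have -> : (fun s => g s * tpois r N t s) = (fun s => \sum_(n < N) u n s - g s).
  apply: funext => s; rewrite /tpois mulrBr mulr1 mulr_sumr; congr (_ - _).
  by apply: eq_bigr => n _; rewrite /u; ring.
rewrite (cIB _ _ (cbdd_sum u N cu) cg) (cI_sum u N cu); congr (_ - _).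
apply: eq_bigr => n _; rewrite cI_lincomb//.
  exact: cbdd_mul_ceitVX.
exact: cbdd_mul_ceitX.
Qed.

Let sum_mulC (a b c x y : R[i]) : c * (a * x + b * y) = c * (x * a + y * b).
Proof. by rewrite [a * x]mulrC [b * y]mulrC. Qed.

Let sum_mulC_swap (a b c x y : R[i]) : c * (x * a + y * b) = c * (b * y + a * x).
Proof. by rewrite addrC [x * a]mulrC [y * b]mulrC. Qed.

(** As a bilinear expression in Fourier coefficients, the pairing shows both its symmetry and its
    vanishing on suitable analytic factors. *)
Lemma cI_mul_tpoisI r N k g : cbdd k ->
  cI (fun t => k t * tpoisI r N g t) =
  \sum_(n < N) Complex (r ^+ n) 0 *
    (cI (fun t => k t * ceit t ^+ n) * cI (fun s => g s * (ceit s)^-1 ^+ n) +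
     cI (fun t => k t * (ceit t)^-1 ^+ n) * cI (fun s => g s * ceit s ^+ n))
  - cI k * cI g.
Proof.
move=> ck.
pose a n : R[i] := cI (fun s => g s * (ceit s)^-1 ^+ n).
pose b n : R[i] := cI (fun s => g s * ceit s ^+ n).
pose u n t : R[i] := Complex (r ^+ n) 0 *
  (a n * (k t * ceit t ^+ n) + b n * (k t * (ceit t)^-1 ^+ n)).
have cu n : cbdd (u n).
  by apply/cbddZ/cbddD; apply: cbddZ; [exact: cbdd_mul_ceitX|exact: cbdd_mul_ceitVX].
have -> : (fun t => k t * tpoisI r N g t) =
    (fun t => \sum_(n < N) u n t - cI g * k t).
  apply: funext => t; rewrite /tpoisI mulrBr mulr_sumr [k t * cI g]mulrC; congr (_ - _).
  by apply: eq_bigr => n _; rewrite /u -/(a n) -/(b n); ring.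
rewrite (cIB _ _ (cbdd_sum u N cu) (cbddZ (cI g) _ ck)) (cI_sum u N cu).
rewrite (cIZ _ _ ck) [cI g * _]mulrC; congr (_ - _).
apply: eq_bigr => n _; rewrite cI_lincomb.
- exact: sum_mulC.
- exact: cbdd_mul_ceitX.
- exact: cbdd_mul_ceitVX.
Qed.

Lemma cI_tpoisI_sym r N k g : cbdd k -> cbdd g ->
  cI (fun t => k t * tpoisI r N g t) = cI (fun t => g t * tpoisI r N k t).
Proof.
move=> ck cg; rewrite !cI_mul_tpoisI// [cI k * _]mulrC; congr (_ - _).
by apply: eq_bigr => n _; exact: sum_mulC_swap.
Qed.

(** * Comparison with the Poisson kernel and convergence of the truncated operator *)

Definition rceit r t : R[i] := Complex r 0 * ceit t.

Lemma cmod_rceit r t : 0 <= r -> cmod (rceit r t) = r.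
Proof. by move=> r0; rewrite cmodM cmod_ceit mulr1 cmod_real ger0_norm. Qed.

Lemma disc_rceit r t : 0 <= r < 1 -> disc (rceit r t).
Proof. by move=> /andP[r0 r1]; rewrite /disc/= cmod_rceit. Qed.

Lemma cauchyk_trunc z s N : disc z -> cauchyk z s =
  \sum_(n < N) z ^+ n * (ceit s)^-1 ^+ n + z ^+ N * (ceit s)^-1 ^+ N * cauchyk z s.
Proof.
move=> zd; elim: N => [|N ih]; first by rewrite big_ord0 !expr0 !mul1r add0r.
rewrite {1}ih big_ord_recr/= -addrA; congr (_ + _).
by rewrite {1}cauchyk_rec// !exprSr; ring.
Qed.

(** The difference is $-E-\bar E$, where $E$ is the exact remainder in [cauchyk_trunc], and $|E| \le
    r^N/(1-r)$. *)
Lemma tpois_pois r N t s : 0 <= r < 1 ->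
  cmod (tpois r N t s - Complex (pois (rceit r t) s) 0) <= 2 * (r ^+ N / (1 - r)).
Proof.
move=> rr; have zd := disc_rceit r t rr; have /andP[r0 r1] := rr.
pose z := rceit r t; pose E : R[i] := z ^+ N * (ceit s)^-1 ^+ N * cauchyk z s.
have K : cauchyk z s = \sum_(n < N) z ^+ n * (ceit s)^-1 ^+ n + E.
  exact: cauchyk_trunc.
have cz : conjc z = Complex r 0 * (ceit t)^-1.
  by rewrite /z /rceit conjcM conj_ceit; congr (_ * _); rewrite /conjc oppr0.
have rX n : Complex r 0 ^+ n = Complex (r ^+ n) 0 :> R[i].
  by rewrite -[RHS]/(real_complex R (r ^+ n)) rmorphXn.
have -> : tpois r N t s - Complex (pois (rceit r t) s) 0 = - E - conjc E.
  rewrite complex_pois// K conjcD rmorph_sum/= /tpois.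
  have -> : \sum_(n < N) Complex (r ^+ n) 0 *
    (ceit t ^+ n * (ceit s)^-1 ^+ n + (ceit t)^-1 ^+ n * ceit s ^+ n) =
    \sum_(n < N) z ^+ n * (ceit s)^-1 ^+ n +
    \sum_(n < N) conjc (z ^+ n * (ceit s)^-1 ^+ n).
    rewrite -big_split/=; apply: eq_bigr => n _.
    rewrite conjcM !conjcX conjc_inv conj_ceit invrK cz /z /rceit !exprMn rX.
    by rewrite mulrDr !mulrA.
  by move: (\sum_(n < N) _) (\sum_(n < N) _) => x y; ring.
have Ele : cmod E <= r ^+ N / (1 - r).
  rewrite cmodM cmodM !cmodX cmodV cmod_ceit invr1 expr1n mulr1 cmod_rceit//.
  by rewrite ler_wpM2l ?exprn_ge0// (le_trans (cmod_cauchyk_le _ _ zd))// cmod_rceit.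
rewrite (le_trans (ler_cmodD _ _))// !cmodN cmod_conj.
by rewrite mulr_natl mulr2n lerD.
Qed.

(** The truncated kernel is at most $P + 1$ in modulus, of total mass $2\cdot 2\pi$; the other
    factor 2 is that of [cmod_cI_le_Rint]. *)
Lemma cmod_tpoisI_le r N g t (M : R) : cbdd g -> 0 <= M -> aebd g M -> 0 <= r < 1 ->
  2 * (r ^+ N / (1 - r)) <= 1 -> cmod (tpoisI r N g t) <= 4 * M * (2 * pi).
Proof.
move=> cg M0 gM rr rN; have zd := disc_rceit r t rr.
rewrite tpoisIE//.
have rq : rbdd (fun s => pois (rceit r t) s + 1).
  by apply: rbddD; [exact: rbdd_pois|exact: rbdd_cst].
apply: le_trans (cmod_cI_le_Rint _ (fun s => M * (pois (rceit r t) s + 1)) _ _ _) _.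
- by apply: cbddM => //; exact: cbdd_tpois.
- by apply: rbddM => //; exact: rbdd_cst.
- apply: aeS gM => s gM sI; rewrite cmodM ler_pM ?cmod_ge0 ?gM//.
  rewrite -[tpois _ _ _ _](subrK (Complex (pois (rceit r t) s) 0)).
  rewrite (le_trans (ler_cmodD _ _))// addrC lerD//.
    by rewrite cmod_real ger0_norm// pois_ge0.
  exact: le_trans (tpois_pois _ _ _ _ rr) rN.
rewrite RintZ// RintD//; [|exact: rbdd_pois|exact: rbdd_cst].
by rewrite Rint_pois// -/(cst (1 : R)) Rint_cst; lra.
Qed.

(** The approximate identity argument. The bound on [1 - r] concentrates the Poisson kernel at [t],
    and the bound on $r^N/(1-r)$ makes the truncation harmless. *)
Lemma tpoisI_approx k t (M eps : R) : 0 < t < 2 * pi ->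
  continuous (fun s => cRe (k s)) -> continuous (fun s => cIm (k s)) ->
  0 <= M -> (forall s, I02 s -> cmod (k s) <= M) -> 0 < eps ->
  exists2 d : R, 0 < d & forall r N, 0 <= r < 1 -> 1 - r <= d ->
    r ^+ N / (1 - r) <= d ->
    cmod (tpoisI r N k t - Complex (2 * pi) 0 * k t) <= eps.
Proof.
move=> tI kR kI M0 kM eps0; have pi0 := @pi2_gt0 R.
(* The final estimate is $2(\eta+\eta)\,2\pi = \varepsilon$: one $\eta$ for the oscillation of [k]
   near [t], one for all other errors. *)
pose eta := eps / (4 * (2 * pi)).
have eta0 : 0 < eta by rewrite divr_gt0// mulr_gt0.
have [d1 d10 kd1] : exists2 d1 : R, 0 < d1 & forall s, `|s - t| < d1 -> cmod (k s - k t) <= eta.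
  have e2 : 0 < eta / 2 by rewrite divr_gt0.
  have /cvgrPdist_lt/(_ _ e2)/nbhs_ballP[a /= a0 Ha] := kR t.
  have /cvgrPdist_lt/(_ _ e2)/nbhs_ballP[b /= b0 Hb] := kI t.
  exists (Num.min a b) => [|s]; first by rewrite lt_min a0.
  rewrite lt_min => /andP[sa sb]; rewrite (le_trans (cmod_le_normD _))//.
  have {}Ha := Ha s; have {}Hb := Hb s.
  rewrite /ball/= distrC in Ha; rewrite /ball/= distrC in Hb.
  have := Ha sa; have := Hb sb; rewrite distrC [X in _ -> X < _ -> _]distrC.
  case: (k s) (k t) => [a1 b1] [a2 b2] /=; lra.
have [e e0 He] := ceit_separated t d1 tI d10.
(* The other errors are at most $Cx$ once $1-r$ and $r^N/(1-r)$ are at most $x$. Taking $x \le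
   \eta/(C+1)$ also covers $C = 0$. *)
pose C := M * (16 / e ^+ 2 + 2).
have C0 : 0 <= C by rewrite mulr_ge0// addr_ge0// divr_ge0// exprn_ge0// ltW.
have C1 : 0 < C + 1 by lra.
exists (Num.min (e / 2) (eta / (C + 1))) => [|r N rr].
  by rewrite lt_min; apply/andP; split; exact: divr_gt0.
rewrite !le_min => /andP[re rC] /andP[_ rN].
have /andP[r0 r1] := rr; have zd := disc_rceit r t rr; pose z := rceit r t.
have zt : cmod (z - ceit t) = 1 - r.
  rewrite /z /rceit -{2}[ceit t]mul1r -mulrBl cmodM cmod_ceit mulr1.
  rewrite -[1]/(Complex 1 0) real_complexB cmod_real distrC ger0_norm//; lra.
have ck : cbdd k by split; exact: rbdd_continuous.
have cP := cbdd_pois z zd; have cT := cbdd_tpois r N t.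
have -> : tpoisI r N k t - Complex (2 * pi) 0 * k t =
    cI (fun s => k s * tpois r N t s - k t * Complex (pois z s) 0).
  rewrite cIB; [|exact: cbddM|exact: cbddZ].
  rewrite tpoisIE// cIZ//; congr (_ - _); rewrite mulrC; congr (_ * _).
  exact/esym/cI_pois.
(* The first summand bounds the contribution of points far from [ceit t], by [pois_le_away]; the
   second bounds the truncation error, by [tpois_pois]. *)
pose c := 2 * M * (8 * (1 - r) / e ^+ 2) + M * (2 * (r ^+ N / (1 - r))).
have rP := rbdd_pois z zd.
have rq : rbdd (fun s => eta * pois z s + c).
  by apply: rbddD; [apply: rbddM => //|]; exact: rbdd_cst.
apply: le_trans (cmod_cI_le_Rint _ (fun s => eta * pois z s + c) _ rq _) _.
- by apply: cbddB; [exact: cbddM|exact: cbddZ].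
- apply: aeW => s sI.
  have -> : k s * tpois r N t s - k t * Complex (pois z s) 0 =
    (k s - k t) * Complex (pois z s) 0 + k s * (tpois r N t s - Complex (pois z s) 0) by ring.
  rewrite (le_trans (ler_cmodD _ _))// addrA lerD//; last first.
    by rewrite cmodM ler_pM ?cmod_ge0 ?kM// tpois_pois.
  have P0 := pois_ge0 z s zd.
  rewrite cmodM cmod_real ger0_norm//.
  have [se|se] := ltP (cmod (ceit s - ceit t)) e.
    rewrite -[leLHS]addr0 lerD ?ler_wpM2r ?kd1 ?He//.
    have H0 : 0 <= 8 * (1 - r) / e ^+ 2.
      by rewrite divr_ge0 ?exprn_ge0 ?(ltW e0)// mulr_ge0// subr_ge0 ltW.
    by rewrite (mulr_ge0 _ H0)// mulr_ge0.
  rewrite -[leLHS]add0r; apply: lerD; first exact: mulr_ge0 (ltW eta0) P0.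
  apply: ler_pM => //; first exact: cmod_ge0.
    rewrite (le_trans (ler_cmodD _ _))// cmodN mulr_natl mulr2n lerD ?kM//.
    by case/andP: tI => t0 t1; rewrite /I02/= in_itv/= !ltW.
  by rewrite -zt; apply: pois_le_away => //; [exact: cmod_ceit|rewrite zt].
have -> : Rintegral lam I02 (fun s => eta * pois z s + c) = (eta + c) * (2 * pi).
  rewrite mulrDl -(Rint_cst c) -(Rint_pois z zd) -(RintZ eta _ rP); apply: RintD.
    by apply: rbddM => //; exact: rbdd_cst.
  exact: rbdd_cst.
have cle : c <= eta.
  apply: (@le_trans _ _ (C * (eta / (C + 1)))).
    have -> : c = M * (16 * (1 - r) / e ^+ 2 + 2 * (r ^+ N / (1 - r))) by rewrite /c; ring.
    move: rC rN; set x := eta / (C + 1) => rC rN.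
    have -> : C * x = M * (16 / e ^+ 2 * x + 2 * x) by rewrite /C; ring.
    apply: ler_wpM2l => //; apply: lerD; last by rewrite ler_wpM2l.
    by rewrite mulrAC ler_wpM2l// divr_ge0// exprn_ge0// ltW.
  rewrite mulrCA ler_piMr// ?(ltW eta0)// ler_pdivrMr//; lra.
apply: (@le_trans _ _ (2 * ((eta + eta) * (2 * pi)))).
  by rewrite ler_wpM2l// ler_wpM2r ?(ltW pi0)// lerD2l.
rewrite /eta le_eqVlt; apply/orP; left; apply/eqP.
by move: (2 * pi) (lt0r_neq0 pi0) => x x0; field.
Qed.

Lemma exists_radii : exists (r : nat -> R) (N : nat -> nat), forall j,
  [/\ 0 <= r j < 1, 1 - r j <= j.+1%:R^-1, 2 * (r j ^+ N j / (1 - r j)) <= 1 &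
      r j ^+ N j / (1 - r j) <= j.+1%:R^-1].
Proof.
suff H j : exists p : R * nat, [/\ 0 <= p.1 < 1, 1 - p.1 <= j.+1%:R^-1,
   2 * (p.1 ^+ p.2 / (1 - p.1)) <= 1 & p.1 ^+ p.2 / (1 - p.1) <= j.+1%:R^-1].
  have [p Hp] := choice H.
  by exists (fun j => (p j).1), (fun j => (p j).2).
have j2 : 0 < j.+2%:R^-1 :> R by rewrite invr_gt0.
have j2h : j.+2%:R^-1 <= 2^-1 :> R by rewrite lef_pV2 ?posrE// ler_nat.
have j21 : j.+2%:R^-1 <= j.+1%:R^-1 :> R by rewrite lef_pV2 ?posrE// ler_nat.
(* The radius is chosen first and the degree [N] afterwards, so that $r^N \le (1-r)/(j+2)$. The
   shift to $j+2$ makes $r^N/(1-r)$ at most $1/2$ even for $j=0$. *)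
pose r : R := 1 - j.+2%:R^-1.
have rr : 0 <= r < 1.
  by move: j2 j2h; rewrite /r; move: (j.+2%:R^-1) => x x0 x2; apply/andP; split; lra.
have /andP[r0 r1] := rr.
have e0 : 0 < j.+2%:R^-1 * (1 - r) by rewrite mulr_gt0// subr_gt0.
have : (fun n => r ^+ n) @ \oo --> 0 by apply: cvg_expr; rewrite ger0_norm.
move=> /cvgrPdist_lt/(_ _ e0)[N _ /(_ N (leqnn N))].
rewrite sub0r normrN ger0_norm ?exprn_ge0// => /ltW HN.
have H : r ^+ N / (1 - r) <= j.+2%:R^-1 by rewrite ler_pdivrMr// subr_gt0.
exists (r, N); split => //=.
- by rewrite /r opprB addrCA subrr addr0.
- rewrite (le_trans (ler_wpM2l _ H))//; move: j2h; move: (j.+2%:R^-1) => x; lra.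
- exact: le_trans H j21.
Qed.

Lemma ae_interior_I02 : {ae lam, forall t, I02 t -> 0 < t < 2 * pi}.
Proof.
exists ([set 0] `|` [set 2 * pi]); split.
- by apply: measurableU; exact: measurable_set1.
- apply/eqP; rewrite -measure_le0.
  apply: le_trans (measureU2 lam (measurable_set1 (0 : R)) (measurable_set1 (2 * pi : R))) _.
  rewrite le_eqVlt; apply/orP; left; apply/eqP; rewrite -[RHS]adde0.
  exact: (congr2 adde (lebesgue_measure_set1 _) (lebesgue_measure_set1 _)).
- move=> t /= /not_implyP[]; rewrite /Defs.I02/= in_itv/= => /andP[t0 t1] tn.
  have [->|tn0] := eqVneq t 0; first by left.
  right; apply/eqP; have [//|tn1] := eqVneq t (2 * pi).
  by exfalso; apply: tn; rewrite !lt_neqAle t0 t1 eq_sym tn0 tn1.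
Qed.

(** Convergence at interior parameters, hence a.e., is upgraded to $L^1$ convergence by dominated
    convergence. *)
Lemma tpoisI_dense k (eps : R) :
  continuous (fun s => cRe (k s)) -> continuous (fun s => cIm (k s)) -> 0 < eps ->
  exists r N, [/\ 0 <= r < 1, 2 * (r ^+ N / (1 - r)) <= 1 &
    L1 (fun t => Complex (2 * pi)^-1 0 * tpoisI r N k t - k t) <= eps].
Proof.
move=> kR kI eps0; have pi0 := @pi2_gt0 R; have pin0 := lt0r_neq0 pi0.
have ck : cbdd k by split; exact: rbdd_continuous.
have [M M0 kM] : exists2 M : R, 0 <= M & forall s, I02 s -> cmod (k s) <= M.
  have bnd (h : R -> R) : continuous h -> exists2 M : R, 0 <= M & forall s, I02 s -> `|h s| <= M.
    move=> ch; have : compact (h @` I02).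
      apply: continuous_compact; last exact: segment_compact.
      exact: continuous_subspaceT.
    move=> /compact_bounded[M [_ HM]]; exists (`|M| + 1) => [|s sI]; first by rewrite addr_ge0.
    by apply: (HM (`|M| + 1)); [rewrite (le_lt_trans (ler_norm _))// ltrDl|exists s].
  have [M1 M10 H1] := bnd _ kR; have [M2 M20 H2] := bnd _ kI.
  exists (M1 + M2) => [|s sI]; first exact: addr_ge0.
  by rewrite (le_trans (cmod_le_normD _))// lerD ?H1 ?H2.
have [r [N rN]] := exists_radii.
pose p j t : R[i] := Complex (2 * pi)^-1 0 * tpoisI (r j) (N j) k t.
have cp j : cbdd (p j) by apply/cbddZ/cbdd_tpoisI.
(* The dominating constant: the bound of [cmod_tpoisI_le] divided by $2\pi$. *)
have pM j t : cmod (p j t) <= 4 * M.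
  have [rr _ rN1 _] := rN j.
  rewrite cmodM cmod_real ger0_norm ?invr_ge0 ?(ltW pi0)// mulrC ler_pdivrMr//.
  by apply: cmod_tpoisI_le => //; apply: aeW.
have pk t : 0 < t < 2 * pi -> forall e, 0 < e -> \forall j \near \oo, cmod (p j t - k t) < e.
  move=> tI e e0.
  have e0' : 0 < (2 * pi) * (e / 2) by rewrite mulr_gt0// divr_gt0.
  have [d d0 Hd] := tpoisI_approx k t M _ tI kR kI M0 kM e0'.
  have := near_infty_natSinv_lt (PosNum d0); apply: filterS => j /= /ltW jd.
  have [rr r1 _ rNj] := rN j.
  have {}Hd := Hd _ _ rr (le_trans r1 jd) (le_trans rNj jd).
  have -> : p j t - k t = Complex (2 * pi)^-1 0 *
      (tpoisI (r j) (N j) k t - Complex (2 * pi) 0 * k t).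
    have E : Complex (2 * pi)^-1 0 * Complex (2 * pi) 0 = 1 :> R[i].
      by rewrite real_complexM mulVf.
    by rewrite /p -{1}[k t]mul1r -E; ring.
  rewrite cmodM cmod_real ger0_norm ?invr_ge0 ?(ltW pi0)// mulrC ltr_pdivrMr//.
  rewrite (le_lt_trans Hd)// mulrC ltr_pM2r//; lra.
have cvR : Rintegral lam I02 (fun t => `|cRe (p n t) - cRe (k t)|) @[n --> \oo] --> 0.
  apply: (Rint_dominated _ _ (4 * M)).
  - by move=> n; case: (cp n).
  - by case: ck.
  - by move=> n; apply: aeW => t _; rewrite (le_trans (norm_Re_le_cmod _)).
  - apply: aeS ae_interior_I02 => t tI /tI /pk tpk; apply/cvgrPdist_lt => e /tpk.
    apply: filterS => j; apply: le_lt_trans; rewrite distrC.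
    have -> : cRe (p j t) - cRe (k t) = cRe (p j t - k t) by case: (p j t) (k t) => a b [].
    exact: norm_Re_le_cmod.
have cvI : Rintegral lam I02 (fun t => `|cIm (p n t) - cIm (k t)|) @[n --> \oo] --> 0.
  apply: (Rint_dominated _ _ (4 * M)).
  - by move=> n; case: (cp n).
  - by case: ck.
  - by move=> n; apply: aeW => t _; rewrite (le_trans (norm_Im_le_cmod _)).
  - apply: aeS ae_interior_I02 => t tI /tI /pk tpk; apply/cvgrPdist_lt => e /tpk.
    apply: filterS => j; apply: le_lt_trans; rewrite distrC.
    have -> : cIm (p j t) - cIm (k t) = cIm (p j t - k t) by case: (p j t) (k t) => a b [].
    exact: norm_Im_le_cmod.
have e2 : 0 < eps / 2 by rewrite divr_gt0.
have /cvgrPdist_lt/(_ _ e2) [j1 _ H1] := cvR.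
have /cvgrPdist_lt/(_ _ e2) [j2 _ H2] := cvI.
pose j := maxn j1 j2; have [rr _ rN1 _] := rN j.
exists (r j), (N j); split => //; rewrite /L1.
have := H1 j (leq_maxl _ _); have := H2 j (leq_maxr _ _).
rewrite !sub0r !normrN => h2 h1.
have -> : eps = eps / 2 + eps / 2 by lra.
apply: lerD.
  apply: le_trans (ltW (le_lt_trans (ler_norm _) h1)); rewrite le_eqVlt; apply/orP; left.
  by apply/eqP/eq_Rintegral => t _; rewrite -/(p j t); case: (p j t) (k t) => a b [].
apply: le_trans (ltW (le_lt_trans (ler_norm _) h2)); rewrite le_eqVlt; apply/orP; left.
by apply/eqP/eq_Rintegral => t _; rewrite -/(p j t); case: (p j t) (k t) => a b [].
Qed.

Lemma L1_approx_continuous f (eps : R) : cbdd f -> 0 < eps ->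
  exists k, [/\ continuous (fun s => cRe (k s)), continuous (fun s => cIm (k s)) &
    L1 (fun t => f t - k t) <= eps].
Proof.
move=> [fR fI] eps0; have e2 : 0 < eps / 2 by rewrite divr_gt0.
have key (h : R -> R) : rbdd h ->
    exists2 k, continuous k & Rintegral lam I02 (fun t => `|h t - k t|) <= eps / 2.
  move=> rh; have := @approximation_continuous_integrable R I02 h measurable_I02
    lebesgue_I02_lty (rbdd_integrable _ rh).
  move=> [k [ck ik]] /fine_cvgP[_] /cvgrPdist_lt/(_ _ e2)[j _ /(_ j (leqnn j))].
  rewrite sub0r normrN => /ltW H; exists (k j) => //.
  exact: le_trans (ler_norm _) H.
have [kR ckR HR] := key _ fR; have [kI ckI HI] := key _ fI.
exists (fun t => Complex (kR t) (kI t)); split => //.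
have -> : eps = eps / 2 + eps / 2 by lra.
apply: lerD; [apply: le_trans HR|apply: le_trans HI]; rewrite le_eqVlt; apply/orP; left.
  by apply/eqP/eq_Rintegral => t _; case: (f t).
by apply/eqP/eq_Rintegral => t _; case: (f t).
Qed.

End TruncatedPoisson.

(** * The algebra of bounded analytic functions *)

Section AnalyticAlgebra.
Context {R : realType}.
Implicit Types (f g h k : R -> R[i]) (c z w zeta : R[i]) (r s t : R).
Local Notation lam := (@lebesgue_measure R).
Local Notation cRe := (@complex.Re R).
Local Notation cIm := (@complex.Im R).
Local Notation I02 := (@I02 R).
Local Notation cI := (cint lam I02).

Local Opaque cint.

(** Boundary functions of class $H^\infty$: pairing with $e^{i(n+1)t}$ gives, up to normalisation,
    the coefficient of index $-(n+1)$. *)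
Definition analytic g := cbdd g /\ forall n, cI (fun t => g t * ceit t ^+ n.+1) = 0.

Lemma analytic_cI_tpoisI r N f g : analytic f -> analytic g ->
  cI (fun t => f t * ceit t * tpoisI r N g t) = 0.
Proof.
move=> [cf f0] [cg g0].
have cfe : cbdd (fun t => f t * ceit t) by exact: (cbddM _ _ cf (@cbdd_ceit R)).
have fe0 n : cI (fun t => f t * ceit t * ceit t ^+ n) = 0.
  rewrite (_ : (fun t => _) = (fun t => f t * ceit t ^+ n.+1)) ?f0//.
  by apply: funext => t; rewrite exprS mulrA.
have fe : cI (fun t => f t * ceit t) = 0.
  rewrite -[RHS](fe0 0%N); congr cint; apply: funext => t.
  by rewrite expr0 mulr1.
rewrite (cI_mul_tpoisI r N _ g cfe) fe mul0r subr0.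
(* For index 0 both products contain the vanishing integral of [f t * ceit t]; for positive index
   the first contains a vanishing coefficient of [f], the second one of [g]. *)
apply: big1 => -[[|n] nN] _ /=; rewrite fe0 mul0r add0r.
  by rewrite mulr0.
by rewrite g0 !mulr0.
Qed.

(** Relies on [I02] having positive measure: a negative bound would make the integral of $0$ at most
    $2\pi M < 0$. *)
Lemma aebd_ge0 g M : aebd g M -> 0 <= M.
Proof.
move=> gM; rewrite leNgt; apply/negP => M0.
have : Rintegral lam I02 (cst 0) <= Rintegral lam I02 (cst M).
  apply: ae_le_Rint; [exact: rbdd_cst|exact: rbdd_cst|].
  by apply: aeS gM => t gM /gM; apply: le_trans; exact: cmod_ge0.
rewrite !Rint_cst mul0r leNgt => /negP; apply.
by rewrite nmulr_rlt0 ?pi2_gt0.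
Qed.

Lemma cI_analyticM f g : analytic f -> analytic g ->
  cI (fun t => f t * ceit t * g t) = 0.
Proof.
move=> af ag; have [cf _] := af; have [cg _] := ag.
have cfe : cbdd (fun t => f t * ceit t) by exact: (cbddM _ _ cf (@cbdd_ceit R)).
have [_ _ [M gM]] := (cbddP g).1 cg; have M0 := aebd_ge0 _ _ gM.
have pi0 := @pi2_gt0 R; have pin0 := lt0r_neq0 pi0.
have E : Complex (2 * pi)^-1 0 * Complex (2 * pi) 0 = 1 :> R[i].
  by rewrite real_complexM mulVf.
(* The constant is $2+2+8$: the errors [u1] and [u2] paired with [g], and [u1] paired with the
   truncated Poisson integral of [g]. *)
suff H (eps : R) : 0 < eps -> cmod (cI (fun t => f t * ceit t * g t)) <= (12 * M) * eps.
  apply/eqP; rewrite -cmod_eq0 eq_le cmod_ge0 andbT; apply/ler_addgt0Pr => e e0.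
  have C0 : 0 < 12 * M + 1 by lra.
  rewrite add0r (le_trans (H (e / (12 * M + 1)) _)) ?divr_gt0//.
  rewrite mulrCA ler_piMr ?(ltW e0)// ler_pdivrMr//; lra.
move=> eps0.
have [k [kR kI Hk]] := L1_approx_continuous _ _ cfe eps0.
have ck : cbdd k by split; exact: rbdd_continuous.
have [r [N [rr rN HS]]] := tpoisI_dense _ _ kR kI eps0.
pose a : R[i] := Complex (2 * pi)^-1 0.
have cS := @cbdd_tpoisI R r N k; have cSg := @cbdd_tpoisI R r N g.
pose u1 t := f t * ceit t - k t.
pose u2 t := a * tpoisI r N k t - k t.
have cu1 : cbdd u1 by exact: cbddB.
have cu2 : cbdd u2 by apply: cbddB => //; exact: cbddZ.
have sym : cI (fun t => g t * tpoisI r N k t) = - cI (fun t => u1 t * tpoisI r N g t).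
  have -> : (fun t => u1 t * tpoisI r N g t) =
      (fun t => f t * ceit t * tpoisI r N g t - k t * tpoisI r N g t).
    by apply: funext => t; rewrite /u1 mulrBl.
  rewrite cIB; [|exact: cbddM|exact: cbddM].
  by rewrite analytic_cI_tpoisI// sub0r opprK; exact: cI_tpoisI_sym.
(* Here [u1] is the error of approximating $fe$ by [k], and [u2] that of approximating [k] by its
   normalised Poisson sum. The remaining main term is moved onto [u1] by [sym]. *)
have -> : cI (fun t => f t * ceit t * g t) =
    cI (fun t => u1 t * g t) - cI (fun t => u2 t * g t) -
    a * cI (fun t => u1 t * tpoisI r N g t).
  have -> : (fun t => f t * ceit t * g t) =
      (fun t => u1 t * g t - u2 t * g t + a * (g t * tpoisI r N k t)).
    by apply: funext => t; rewrite /u1 /u2; ring.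
  rewrite (cID _ _ (cbddB _ _ (cbddM _ _ cu1 cg) (cbddM _ _ cu2 cg))
    (cbddZ a _ (cbddM _ _ cg cS))).
  rewrite (cIB _ _ (cbddM _ _ cu1 cg) (cbddM _ _ cu2 cg)) (cIZ a _ (cbddM _ _ cg cS)).
  by rewrite sym mulrN.
have b1 := cmod_cI_le _ _ _ cu1 cg gM.
have b2 := cmod_cI_le _ _ _ cu2 cg gM.
have b3 : cmod (cI (fun t => u1 t * tpoisI r N g t)) <= 2 * (4 * M * (2 * pi) * L1 u1).
  by apply: cmod_cI_le => //; apply: aeW => t _; exact: cmod_tpoisI_le.
rewrite (le_trans (ler_cmodD _ _))// cmodN cmodM cmod_real ger0_norm ?invr_ge0 ?(ltW pi0)//.
have b12 := ler_cmodD (cI (fun t => u1 t * g t)) (- cI (fun t => u2 t * g t)).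
rewrite cmodN in b12.
have b3' : (2 * pi)^-1 * cmod (cI (fun t => u1 t * tpoisI r N g t)) <= 8 * (M * eps).
  rewrite mulrC ler_pdivrMr// (le_trans b3)//.
  have -> : 2 * (4 * M * (2 * pi) * L1 u1) = 8 * (2 * pi) * M * L1 u1 by ring.
  have -> : 8 * (M * eps) * (2 * pi) = 8 * (2 * pi) * M * eps by ring.
  by rewrite ler_wpM2l// !mulr_ge0// ltW// pi_gt0.
have M1 : M * L1 u1 <= M * eps by rewrite ler_wpM2l.
have M2 : M * L1 u2 <= M * eps by rewrite ler_wpM2l.
move: b1 b2 b12 b3' M1 M2.
move: (cmod (cI (fun t => u1 t * g t))) (cmod (cI (fun t => u2 t * g t)))
  (cmod (_ - _)) (_^-1 * _) (M * L1 u1) (M * L1 u2) => x1 x2 x3 x4 x5 x6.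
have -> : 12 * M * eps = 12 * (M * eps) by ring.
move: (M * eps) => y; lra.
Qed.

Lemma analytic_shift f n : analytic f -> analytic (fun t => f t * ceit t ^+ n).
Proof.
move=> [cf f0]; split; first exact: cbdd_mul_ceitX.
move=> m; rewrite -[RHS](f0 (n + m)%N); congr cint; apply: funext => t.
by rewrite -mulrA -exprD addnS.
Qed.

(** The factor $e^{int}$ is absorbed into [f], so the single integral of [cI_analyticM] yields all
    negative coefficients. *)
Lemma analyticM f g : analytic f -> analytic g -> analytic (fun t => f t * g t).
Proof.
move=> af ag; have [cf _] := af; have [cg _] := ag; split; first exact: cbddM.
move=> n; rewrite -[RHS](cI_analyticM _ _ (analytic_shift f n af) ag).
by congr cint; apply: funext => t; rewrite exprSr; ring.
Qed.

Lemma analytic_subr_const f c : analytic f -> analytic (fun t => f t - c).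
Proof.
move=> [cf f0]; split; first by apply: cbddB => //; exact: cbdd_cst.
move=> n; have ce : cbdd (fun t => ceit t ^+ n.+1 : R[i]) by exact/cbddX/cbdd_ceit.
have -> : (fun t => (f t - c) * ceit t ^+ n.+1) =
    (fun t => f t * ceit t ^+ n.+1 - c * ceit t ^+ n.+1).
  by apply: funext => t; rewrite mulrBl.
rewrite (cIB _ _ (cbddM _ _ cf ce) (cbddZ c _ ce)) f0 (cIZ c _ ce).
by rewrite cI_ceitX// mulr0 subr0.
Qed.

Definition cauchyI f z : R[i] :=
  Complex (2 * pi)^-1 0 * cI (fun t => f t * cauchyk z t).

(** Division of $f - f(z)$ by $e^{it}-z$ at the level of coefficients: the integrals $\int h e^{int}
    K_z$ vanish for $n=0$ by the choice of the constant $f(z)$, and [cauchyk_shift] passes from $n$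
    to $n+1$. *)
Lemma analytic_quotient f z : analytic f -> disc z ->
  analytic (fun t => (f t - cauchyI f z) * (ceit t - z)^-1).
Proof.
move=> af zd; have [cf f0] := af.
have [ch h0] := analytic_subr_const f (cauchyI f z) af.
pose h t := f t - cauchyI f z.
split; first by apply: (cbddM h) => //; exact: cbdd_ceitBV.
have cK := cbdd_cauchyk z zd.
pose u n t := h t * ceit t ^+ n * cauchyk z t.
have cu n : cbdd (u n) by apply: cbddM => //; exact: cbdd_mul_ceitX.
have E : Complex (2 * pi) 0 * Complex (2 * pi)^-1 0 = 1 :> R[i].
  by rewrite real_complexM mulfV// lt0r_neq0// pi2_gt0.
have u0 : cI (u 0%N) = 0.
  have -> : u 0%N = fun t => f t * cauchyk z t - cauchyI f z * cauchyk z t.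
    by apply: funext => t; rewrite /u /h expr0 mulr1 mulrBl.
  rewrite (cIB _ _ (cbddM _ _ cf cK) (cbddZ _ _ cK)) (cIZ _ _ cK) cI_cauchyk//.
  by rewrite mulrC /cauchyI mulrA E mul1r subrr.
have un n : cI (u n) = 0.
  elim: n => // n ih.
  have -> : u n.+1 = fun t => h t * ceit t ^+ n.+1 + z * u n t.
    apply: funext => t; rewrite /u exprSr.
    have -> : h t * (ceit t ^+ n * ceit t) * cauchyk z t =
      h t * ceit t ^+ n * (ceit t * cauchyk z t) by ring.
    by rewrite cauchyk_shift//; ring.
  rewrite (cID _ _ (cbdd_mul_ceitX h n.+1 ch) (cbddZ z _ (cu n))) (cIZ z _ (cu n)).
  by rewrite ih mulr0 addr0 h0.
move=> n; rewrite -[RHS](un n); congr cint; apply: funext => t.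
by rewrite /u /cauchyk -/(h t) exprSr; ring.
Qed.

(** Multiplicativity of the Poisson integral on analytic functions. Writing $f = f(z) +
    q\,(e^{it}-z)$, the part with $q$ becomes by [ceitB_pois] an integral of $g q e^{it}$ against a
    conjugate Cauchy kernel, which is zero because $gq$ is analytic. *)
Lemma cI_analytic_pois_factor f g z : analytic f -> analytic g -> disc z ->
  cI (fun t => g t * f t * Complex (pois z t) 0) =
  cauchyI f z * cI (fun t => g t * Complex (pois z t) 0).
Proof.
move=> af ag zd; have [cf _] := af; have [cg _] := ag.
pose q t := (f t - cauchyI f z) * (ceit t - z)^-1.
have [cgq gq0] := analyticM _ _ ag (analytic_quotient f z af zd).
have cP := cbdd_pois z zd.
have cK : cbdd (fun t => conjc (cauchyk z t)) by exact/cbdd_conj/cbdd_cauchyk.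
pose c := Complex (1 - cmod z ^+ 2) 0.
have cv : cbdd (fun t => g t * q t * ceit t * conjc (cauchyk z t)).
  by apply: cbddM => //; apply: cbddM => //; exact: cbdd_ceit.
have -> : (fun t => g t * f t * Complex (pois z t) 0) =
    (fun t => cauchyI f z * (g t * Complex (pois z t) 0) +
              c * (g t * q t * ceit t * conjc (cauchyk z t))).
  apply: funext => t.
  have -> : c * (g t * q t * ceit t * conjc (cauchyk z t)) =
      g t * q t * ((ceit t - z) * Complex (pois z t) 0).
    by rewrite ceitB_pois// /c; ring.
  have ez := ceit_subr_neq0 z t zd.
  have qE : q t * (ceit t - z) = f t - cauchyI f z by rewrite /q mulfVK.
  have -> : g t * q t * ((ceit t - z) * Complex (pois z t) 0) =
    g t * (q t * (ceit t - z)) * Complex (pois z t) 0 by ring.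
  by rewrite qE; ring.
rewrite (cID _ _ (cbddZ _ _ (cbddM _ _ cg cP)) (cbddZ c _ cv)).
rewrite (cIZ _ _ (cbddM _ _ cg cP)) (cIZ c _ cv).
rewrite [X in _ + c * X](_ : _ = 0) ?mulr0 ?addr0//.
apply: (cI_conj_cauchyk_eq0 (fun t => g t * q t * ceit t) z zd).
  by apply: cbddM => //; exact: cbdd_ceit.
move=> n; rewrite -[RHS](gq0 n); congr cint; apply: funext => t.
by rewrite exprS mulrA.
Qed.

End AnalyticAlgebra.

(** * Singular measures and Blaschke products *)

Section SingularMeasures.
Context {R : realType}.
Implicit Types (z w zeta : R[i]) (s t : R) (mu : {measure set R -> \bar R}).
Local Notation lam := (@lebesgue_measure R).
Local Notation Ico02 := (@Ico02 R).

(** On [E] the measure is dominated by $C$ times length on intervals, hence on countable covers of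
    the null set [N] of arbitrarily small total length. *)
Lemma null_of_interval_bound mu (E N : set R) (C : R) : 0 <= C ->
  measurable E -> measurable N -> lam N = 0%E ->
  (forall a b : R, a < b -> (mu (E `&` `]a, b]%classic) <= (C * (b - a))%:E)%E) ->
  mu (E `&` N) = 0%E.
Proof.
move=> C0 mE mN N0 muE; apply/eqP; rewrite eq_le measure_ge0 andbT.
apply/lee_addgt0Pr => e e0; rewrite add0e.
have C1 : 0 < C + 1 by lra.
have e0' : 0 < e / (C + 1) by rewrite divr_gt0.
(* Unfolds Lebesgue measure as an infimum over countable covers by half-open intervals; [C + 1]
   guards against [C = 0]. *)
have /ereal_inf_lt[z [/= F covF sF zlt]] : (lam N < (e / (C + 1))%:E)%E.
  by rewrite N0 lte_fin.
have ocF n : ocitv (F n) by case: covF => /(_ n).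
have mF n : measurable (F n : set R).
  by have /ocitvP[->|[[a b] /= _ ->]] := ocF n; [exact: measurable0|exact: measurable_itv].
have lF n : (0 <= wlength idfun (F n) /\ mu (E `&` F n) <= C%:E * wlength idfun (F n))%E.
  have /ocitvP[->|[[a b] /= ab ->]] := ocF n.
    set l := wlength _ _; have -> : l = 0%E by exact: wlength0.
    by rewrite setI0 measure0 mule0.
  set l := wlength _ _; have -> : l = (b - a)%:E.
    by apply: wlength_itv_bnd; exact: ltW.
  rewrite -EFinM lee_fin subr_ge0 (ltW ab); split => //.
  exact: muE.
apply: (@le_trans _ _ (\sum_(0 <= n <oo) mu (E `&` F n))%E).
  apply: (measure_sigma_subadditive mu).
  - by move=> n; exact: measurableI.
  - exact: measurableI.
  - by move=> x [Ex Nx]; case: covF => _ /(_ x Nx)[n _ Fx]; exists n.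
apply: (@le_trans _ _ (\sum_(0 <= n <oo) (C%:E * wlength idfun (F n)))%E).
  by apply: lee_nneseries => n *; [exact: measure_ge0|exact: (lF n).2].
rewrite nneseriesZl; last by move=> n _; exact: (lF n).1.
rewrite sF; apply: (@le_trans _ _ (C%:E * (e / (C + 1))%:E)%E).
  by apply: lee_wpmul2l; [rewrite lee_fin|exact: ltW].
by rewrite -EFinM lee_fin mulrCA ler_piMr ?(ltW e0)// ler_pdivrMr//; lra.
Qed.

Lemma measurable_Ico02 : measurable Ico02.
Proof. exact: measurable_itv. Qed.

Lemma measurable_arc zeta (e : R) : 0 <= e ->
  measurable [set t : R | cmod (ceit t - zeta) < e].
Proof.
move=> e0; have -> : [set t : R | cmod (ceit t - zeta) < e] =
    (fun t => cmod (ceit t - zeta) ^+ 2) @^-1` [set x | x < e ^+ 2].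
  apply/seteqP; split => t /=; first by move=> h; rewrite ltrXn2r// cmod_ge0.
  by rewrite ltr_pXn2r ?nnegrE ?cmod_ge0.
apply: open_measurable; apply: open_comp; last exact: open_lt.
by move=> x _; exact: continuous_cmod_ceitB.
Qed.

(** At the point $(1-h)e^{it}$ the numerator $1-(1-h)^2$ is at least $h$, and the denominator is at
    most $(2h)^2$. *)
Lemma pois_ge_near t s (h : R) : 0 < h < 1 -> `|s - t| <= h ->
  (4 * h)^-1 <= pois (rceit (1 - h) t) s.
Proof.
move=> /andP[h0 h1] sth.
have rr : 0 <= 1 - h < 1 by apply/andP; split; lra.
have zd := disc_rceit _ t rr; have c0 := cmod_ceitB_gt0 _ s zd.
have c2 : cmod (ceit s - rceit (1 - h) t) <= 2 * h.
  have -> : ceit s - rceit (1 - h) t = (ceit s - ceit t) + Complex h 0 * ceit t.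
    have -> : Complex h 0 = 1 - Complex (1 - h) 0 :> R[i].
      by rewrite -[1 in RHS]/(Complex 1 0) real_complexB opprB addrCA subrr addr0.
    by rewrite /rceit; ring.
  rewrite (le_trans (ler_cmodD _ _))// cmodM cmod_ceit mulr1 cmod_real.
  rewrite (ger0_norm (ltW h0)); have := ceit_lipschitz s t; lra.
rewrite /pois cmod_rceit; last by lra.
have -> : (4 * h)^-1 = h / (2 * h) ^+ 2 by field; lra.
apply: ler_pM; [exact: ltW|by rewrite invr_ge0 exprn_ge0// mulr_ge0// ltW|nra|].
rewrite lef_pV2 ?posrE ?exprn_gt0 ?mulr_gt0//.
by rewrite lerXn2r ?nnegrE ?cmod_ge0// mulr_ge0// ltW.
Qed.

(** Evaluating the bounded Poisson integral at $(1-h)e^{it}$ bounds the mass of an interval of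
    radius $h$ about $t$ by $4|K|h$. So [mu] is Lipschitz near [zeta], which singularity allows only
    for the zero measure. *)
Lemma sing_null_of_poisson_bounded mu (N : set R) zeta (e K : R) :
  (mu setT < +oo)%E -> measurable N -> lam N = 0%E -> mu (~` N) = 0%E -> 0 < e ->
  (forall z, disc z -> cmod (z - zeta) < e -> Rintegral mu Ico02 (pois z) <= K) ->
  mu [set t : R | Ico02 t /\ cmod (ceit t - zeta) < e / 2] = 0%E.
Proof.
move=> mufin mN N0 muN e0 muK.
pose E := [set t : R | Ico02 t /\ cmod (ceit t - zeta) < e / 2].
have mE : measurable E.
  apply: measurableI; first exact: measurable_Ico02.
  by apply: measurable_arc; rewrite divr_ge0// ltW.
have multy (A : set R) : measurable A -> (mu A < +oo)%E.
  move=> mA; apply: le_lt_trans mufin; apply: le_measure; rewrite ?inE//.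
have local_bound t (h : R) : E t -> 0 < h < 1 -> h < e / 2 ->
    (mu (E `&` `[(t - h)%R, (t + h)%R]%classic) <= (4 * `|K| * h)%:E)%E.
  move=> [_ tz] hh he; have /andP[h0 h1] := hh.
  have rr : 0 <= 1 - h < 1 by apply/andP; split; lra.
  pose z := rceit (1 - h) t; have zd : disc z := disc_rceit _ t rr.
  have zz : cmod (z - zeta) < e.
    have -> : z - zeta = (ceit t - zeta) - Complex h 0 * ceit t.
      have -> : Complex h 0 = 1 - Complex (1 - h) 0 :> R[i].
        by rewrite -[1 in RHS]/(Complex 1 0) real_complexB opprB addrCA subrr addr0.
      by rewrite /z /rceit; ring.
    rewrite (le_lt_trans (ler_cmodD _ _))// cmodN cmodM cmod_ceit mulr1 cmod_real.
    by rewrite (ger0_norm (ltW h0)); lra.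
  have {}muK := muK z zd zz.
  pose A := E `&` `[(t - h)%R, (t + h)%R]%classic.
  have mA : measurable A by apply: measurableI => //; exact: measurable_itv.
  have AI : A `<=` Ico02 by move=> x [[]].
  have mP : measurable_fun Ico02 (EFin \o pois z).
    apply/measurable_EFinP; apply: measurable_funTS.
    by apply: continuous_measurable_fun; exact: continuous_pois.
  have P0 x : 0 <= pois z x by exact: pois_ge0.
  (* Integrability makes [Rintegral] the genuine integral and not the default value of [fine] at
     infinity. *)
  have iP : mu.-integrable Ico02 (EFin \o pois z).
    apply: measurable_bounded_integrable.
    - exact: measurable_Ico02.
    - by apply: multy; exact: measurable_Ico02.
    - exact/measurable_EFinP.
    - exists (2 / h ^+ 2); split; first exact: num_real.
      move=> x hx s _ /=; apply: le_trans (ltW hx); rewrite ger0_norm//.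
      have c0 := cmod_ceitB_gt0 z s zd.
      have c1 : h <= cmod (ceit s - z).
        by apply: le_trans (cmod_ceitB_ge z s); rewrite cmod_rceit; lra.
      rewrite /pois; apply: ler_pM.
      + by rewrite subr_ge0 expr_le1// ?cmod_ge0// ltW.
      + by rewrite invr_ge0 exprn_ge0// ltW.
      + have := sqr_ge0 (cmod z); lra.
      + rewrite lef_pV2 ?posrE ?exprn_gt0// lerXn2r ?nnegrE//; first exact: ltW.
        exact: ltW.
  have h4 : 0 < 4 * h by rewrite mulr_gt0.
  have conv_bound (x : \bar R) : (0 <= x)%E -> (x < +oo)%E ->
      (((4 * h)^-1)%:E * x <= K%:E)%E -> (x <= (4 * `|K| * h)%:E)%E.
    case: x => // x x0 _; rewrite -EFinM !lee_fin mulrC ler_pdivrMr// => H.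
    by rewrite (le_trans H)// mulrCA mulrA ler_wpM2r ?(ltW h0)// ler_wpM2l// ler_norm.
  have : (((4 * h)^-1)%:E * mu A <= K%:E)%E.
    rewrite -integral_cst//.
    apply: (@le_trans _ _ (\int[mu]_(x in A) (pois z x)%:E)%E).
      apply: ge0_le_integral => //.
      - by move=> x _; rewrite lee_fin invr_ge0 ltW.
      - exact: measurable_funS measurable_Ico02 AI mP.
      - move=> x [_]; rewrite /= in_itv/= => /andP[x1 x2]; rewrite lee_fin.
        by apply: pois_ge_near => //; rewrite ler_norml; apply/andP; split; lra.
    apply: (@le_trans _ _ (\int[mu]_(x in Ico02) (pois z x)%:E)%E).
      apply: ge0_subset_integral => //; first exact: measurable_Ico02.
      by move=> x _; rewrite lee_fin.
    rewrite -[leLHS]fineK ?lee_fin//.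
    by apply: integrable_fin_num; [exact: measurable_Ico02|exact: iP].
  apply: conv_bound (measure_ge0 mu A) (multy _ mA).
pose eta := Num.min (e / 2) 1.
have eta0 : 0 < eta by rewrite lt_min ltr01 divr_gt0.
pose m := fine (mu setT).
have muTE : mu setT = m%:E by rewrite fineK// ge0_fin_numE.
have m0 : 0 <= m by rewrite fine_ge0.
(* The first term serves intervals shorter than [eta], where [local_bound] applies; for longer ones
   the second term already exceeds the total mass [m]. *)
pose C : R := 4 * `|K| + m / eta.
have C0 : 0 <= C by apply: addr_ge0; [exact: mulr_ge0|exact: divr_ge0 m0 (ltW eta0)].
have EN0 : mu (E `&` N) = 0%E.
  apply: (null_of_interval_bound mu E N C) => // a b ab.
  have ba0 : 0 < b - a by lra.
  have mEab : measurable (E `&` `]a, b]%classic).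
    by apply: measurableI => //; exact: measurable_itv.
  have [small|large] := ltP (b - a) eta; last first.
    apply: (@le_trans _ _ (mu setT)); first by apply: le_measure; rewrite ?inE.
    rewrite muTE lee_fin (@le_trans _ _ (m / eta * (b - a)))//.
      by rewrite mulrAC ler_pdivlMr// ler_wpM2l.
    by rewrite ler_wpM2r ?(ltW ba0)// lerDr mulr_ge0.
  have [->|/set0P[t [Et tab]]] := eqVneq (E `&` `]a, b]%classic) set0.
    by rewrite measure0 lee_fin mulr_ge0// ltW.
  move: small; rewrite lt_min => /andP[s1 s2].
  (* [local_bound] needs a centre in [E], so the interval is enlarged about one of its points [t]
     lying in [E]. *)
  apply: (@le_trans _ _ (mu (E `&` `[(t - (b - a))%R, (t + (b - a))%R]%classic))).
    apply: le_measure; rewrite ?inE//.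
      by apply: measurableI => //; exact: measurable_itv.
    move=> x [Ex xab]; split => //; move: tab xab; rewrite /= !in_itv/=.
    by move=> /andP[? ?] /andP[? ?]; apply/andP; split; lra.
  apply: le_trans (local_bound t _ Et _ s1) _; first by rewrite ba0.
  by rewrite lee_fin ler_wpM2r ?(ltW ba0)// lerDl divr_ge0// ltW.
apply/eqP; rewrite eq_le measure_ge0 andbT.
apply: (@le_trans _ _ (mu (E `&` N) + mu (~` N))%E); last by rewrite EN0 muN adde0.
apply: le_trans (measureU2 mu _ _).
- apply: le_measure; rewrite ?inE//.
    by apply: measurableU; [exact: measurableI|exact: measurableC].
  by move=> x Ex; have [Nx|Nx] := pselect (N x); [left|right].
- exact: measurableI.
- exact: measurableC.
Qed.

End SingularMeasures.

(** * Blaschke products and the modulus of singular inner functions *)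

Section BlaschkeProducts.
Context {R : realType}.
Implicit Types (z w : R[i]) (a : nat -> option R[i]).
Local Notation cRe := (@complex.Re R).
Local Notation cIm := (@complex.Im R).

(** Rests on $|1-\bar w z|^2 - |w-z|^2 = (1-|w|^2)(1-|z|^2) \ge 0$. *)
Lemma cmod_bfac_le1 (b : option R[i]) z : (forall w, b = Some w -> disc w) -> disc z ->
  cmod (bfac b z) <= 1.
Proof.
case: b => [w|]; last by rewrite /= cmod1.
move=> /(_ w erefl) wd zd /=; case: eqP => [_|/eqP w0]; first exact: ltW.
have w0' : 0 < cmod w by rewrite lt_neqAle cmod_ge0 eq_sym cmod_eq0 w0.
have wz : cmod (conjc w * z) < 1.
  rewrite cmodM cmod_conj (le_lt_trans (ler_piMr _ (ltW zd)))//; exact: cmod_ge0.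
have d0 : 0 < cmod (1 - conjc w * z).
  apply: lt_le_trans (ler_cmodDB 1 (- (conjc w * z))).
  by rewrite cmodN cmod1 subr_gt0.
rewrite cmodM cmodM cmodM !cmodV cmod_real ger0_norm ?cmod_ge0// divff ?gt_eqF// mul1r.
rewrite ler_pdivrMr// mul1r -(@ler_pXn2r _ 2) ?nnegrE ?cmod_ge0// -subr_ge0.
have -> : cmod (1 - conjc w * z) ^+ 2 - cmod (w - z) ^+ 2 =
    (1 - cmod w ^+ 2) * (1 - cmod z ^+ 2).
  by rewrite !sqr_cmod; case: w z {w0 w0' wz d0 wd zd} => [w1 w2] [z1 z2] /=; ring.
by rewrite mulr_ge0// subr_ge0 expr_le1// ?cmod_ge0// ltW.
Qed.

Lemma cmod_bprod_le1 a N z : (forall n w, a n = Some w -> disc w) -> disc z ->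
  cmod (bprod a N z) <= 1.
Proof.
move=> ad zd; rewrite /bprod; elim: N => [|N ih]; first by rewrite big_ord0 cmod1.
rewrite big_ord_recr/= cmodM mulr_ile1 ?cmod_ge0//.
by apply: cmod_bfac_le1 => // w; exact: ad.
Qed.

Lemma cmod_blaschke_le1 a z w : (forall n w, a n = Some w -> disc w) -> disc z ->
  blaschke_at a z w -> cmod w <= 1.
Proof.
move=> ad zd [wR wI].
rewrite -(@ler_pXn2r _ 2) ?nnegrE ?cmod_ge0// expr1n sqr_cmod.
have C : (fun N => cmod (bprod a N z) ^+ 2) @ \oo --> cRe w ^+ 2 + cIm w ^+ 2.
  under eq_fun do rewrite sqr_cmod !expr2.
  by rewrite !expr2; apply: cvgD; apply: cvgM.
rewrite -(cvg_lim (@Rhausdorff R) C); apply: limr_le.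
  by apply/cvg_ex; exists (cRe w ^+ 2 + cIm w ^+ 2).
by apply: nearW => N; rewrite expr_le1// ?cmod_ge0// cmod_bprod_le1.
Qed.

(** All partial products past index [n] contain a factor vanishing at [w], so the limit is that of
    an eventually zero sequence. *)
Lemma blaschke_zero a n w b : a n = Some w -> blaschke_at a w b -> b = 0.
Proof.
move=> an [bR bI].
have b0 N : (n < N)%N -> bprod a N w = 0.
  move=> nN; rewrite /bprod (bigD1 (Ordinal nN))//= an /=.
  by case: eqP => [->|_]; rewrite ?subrr ?mulr0 ?mul0r// mul0r.
have lim0 (u : nat -> R) (l : R) : u @ \oo --> l -> (forall N, (n < N)%N -> u N = 0) -> l = 0.
  move=> ul u0; have c0 : u @ \oo --> (0 : R).
    by apply: cvg_near_cst; exists n.+1 => // N /= nN; apply/eqP; rewrite u0.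
  by rewrite -(cvg_lim (@Rhausdorff R) ul) (cvg_lim (@Rhausdorff R) c0).
have hR := lim0 _ _ bR (fun N nN => congr1 cRe (b0 N nN)).
have hI := lim0 _ _ bI (fun N nN => congr1 cIm (b0 N nN)).
by case: b hR hI {bR bI} => x y /= -> ->.
Qed.

Lemma cmod_cexp z : cmod (cexp z) = expR (cRe z).
Proof.
rewrite /cmod/= !exprMn -mulrDr cos2Dsin2 mulr1 sqrtr_sqr ger0_norm// expR_ge0.
Qed.

Lemma cmod_sing_inner (mu : {measure set R -> \bar R}) z : disc z ->
  cmod (sing_inner mu z) = expR (- Rintegral mu (@Ico02 R) (pois z)).
Proof.
move=> zd; rewrite cmod_cexp; congr (expR (- _)); apply: eq_Rintegral => t _.
exact: Re_herglotz.
Qed.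

End BlaschkeProducts.

(** * Saturation *)

Section HardyFunctions.
Context {R : realType}.
Implicit Types (f g : R[i] -> R[i]) (z w zeta : R[i]) (t : R).
Local Notation lam := (@lebesgue_measure R).
Local Notation cRe := (@complex.Re R).
Local Notation cIm := (@complex.Im R).
Local Notation I02 := (@I02 R).
Local Notation cI := (cint lam I02).

Lemma ess_norm_lt f (x : \bar R) : (ess_norm f < x)%E ->
  exists M : R, [/\ 0 <= M, aebd (fun t => f (ceit t)) M & (M%:E < x)%E].
Proof. by move=> /ereal_inf_lt[_ [M [M0 fM] <-] Mx]; exists M. Qed.

Lemma ess_norm_ge0 f : (0 <= ess_norm f)%E.
Proof. by apply: le_ereal_inf_tmp => _ [M [M0 _] <-]; rewrite lee_fin. Qed.

Lemma eq_ess_norm f g :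
  {ae lam, forall t, I02 t -> cmod (f (ceit t)) = cmod (g (ceit t))} ->
  ess_norm f = ess_norm g.
Proof.
move=> fg; congr (ereal_inf (image _ _)); apply/seteqP.
split=> M [M0 H]; split => //.
  by apply: aeS2 fg H => t fg H tI; rewrite -fg// H.
by apply: aeS2 fg H => t fg H tI; rewrite fg// H.
Qed.

Lemma Linf_cbdd f : bmeas f -> (exists M, aebd (fun t => f (ceit t)) M) ->
  cbdd (fun t => f (ceit t)).
Proof. by move=> [fR fI] fM; apply/cbddP; split. Qed.

Lemma fourier_analytic f : cbdd (fun t => f (ceit t)) ->
  (forall n : int, n < 0 -> fourier f n = 0) -> analytic (fun t => f (ceit t)).
Proof.
move=> cf f0; split => // n.
(* [Negz n] is $-(n+1)$, which matches the exponent [n.+1] in [analytic]. *)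
have := f0 (Negz n) isT; rewrite /fourier /tmean => /eqP; rewrite mulf_eq0.
have -> : Complex (2 * pi)^-1 0 == 0 :> R[i] = false.
  by rewrite eq_complex/= eqxx andbT invr_eq0 gt_eqF// pi2_gt0.
rewrite orFb => /eqP H; rewrite -[RHS]H; congr cint; apply: funext => t.
by rewrite NegzE mulrNz mulNr opprK -ceitMn.
Qed.

Lemma Hinf_analytic f : Hinf f -> analytic (fun t => f (ceit t)).
Proof.
move=> [[mf fM] f0]; apply: fourier_analytic => //; apply: Linf_cbdd => //.
by have [M [_ fM' _]] := ess_norm_lt _ _ fM; exists M.
Qed.

Lemma ext_cauchyI f z : ext f z = cauchyI (fun t => f (ceit t)) z.
Proof.
rewrite /ext /tmean /cauchyI; congr (_ * cint _ _ _).
by apply: funext => t; rewrite /cauchyk mulrA.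
Qed.

Lemma Hinf0_cst0 : Hinf0 (fun=> 0 : R[i]).
Proof.
have f0 n : fourier (fun=> 0 : R[i]) n = 0.
  rewrite /fourier /tmean; under eq_fun do rewrite mul0r.
  by rewrite cI_cst mul0r mulr0.
split=> //; split=> //; split; first by split; exact: measurable_cst.
apply: (@le_lt_trans _ _ (0 : R)%:E); last exact: ltry.
apply: ereal_inf_lbound; exists 0 => //; split => //.
by apply: aeW => t _; rewrite cmod0.
Qed.

(** Pointwise, $\Re G \cdot P \ge cP - c/2$: near $\zeta$ because $\Re G \ge c$, elsewhere because
    $(c+M)P \le c/2$. Integration turns the right side into $(c - c/2)\,2\pi$. *)
Lemma poisson_lower_bound (G : R -> R[i]) (M c e : R) zeta z : cbdd G -> aebd G M ->
  0 < c -> 0 < e -> cmod zeta = 1 -> disc z ->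
  {ae lam, forall t, I02 t -> cmod (ceit t - zeta) < e -> c <= cRe (G t)} ->
  cmod (z - zeta) <= e / 2 -> (c + M) * (8 * cmod (z - zeta) / e ^+ 2) <= c / 2 ->
  c / 2 * (2 * pi) <= cmod (cI (fun t => G t * Complex (pois z t) 0)).
Proof.
move=> cG GM c0 e0 zeta1 zd Gc zz zc; have M0 := aebd_ge0 _ _ GM.
have rP := rbdd_pois z zd; have [rG _] := cG.
have cP : rbdd (fun t => c * pois z t) by apply: rbddM => //; exact: rbdd_cst.
apply: le_trans (norm_Re_le_cmod _); apply: le_trans (ler_norm _) => /=.
have -> : c / 2 * (2 * pi) = Rintegral lam I02 (fun t => c * pois z t - c / 2).
  have -> : Rintegral lam I02 (fun t => c * pois z t - c / 2) =
      Rintegral lam I02 (fun t => c * pois z t) - Rintegral lam I02 (cst (c / 2)).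
    by apply: RintB => //; exact: rbdd_cst.
  by rewrite RintZ// Rint_pois// Rint_cst; move: (2 * pi) => x; field.
have -> : Rintegral lam I02 (fun t => cRe (G t * Complex (pois z t) 0)) =
    Rintegral lam I02 (fun t => cRe (G t) * pois z t).
  by apply: eq_Rintegral => t _; rewrite cReM/= mulr0 subr0.
apply: ae_le_Rint.
- by apply: rbddB => //; exact: rbdd_cst.
- exact: rbddM.
apply: aeS2 GM Gc => t GM Gc tI; have P0 := pois_ge0 z t zd.
have [te|te] := ltP (cmod (ceit t - zeta)) e.
  have := Gc tI te => h; have : c * pois z t <= cRe (G t) * pois z t by rewrite ler_wpM2r.
  lra.
have Pe := pois_le_away z zeta e t e0 zeta1 zd zz te.
have h1 : - M <= cRe (G t).
  by have := le_trans (norm_Re_le_cmod (G t)) (GM tI); rewrite ler_norml => /andP[].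
have h2 : - M * pois z t <= cRe (G t) * pois z t by rewrite ler_wpM2r.
have h3 : (c + M) * pois z t <= c / 2.
  by apply: le_trans zc; rewrite ler_wpM2l// addr_ge0// ltW.
move: h2 h3; rewrite mulrDl mulNr; lra.
Qed.

(* [x (conj x - y) = |x|^2 - x y] *)
Lemma Re_mul_ge (x y : R[i]) (D m : R) : 0 <= D -> m <= D -> cmod (x - conjc y) <= m ->
  D <= cmod x -> D * (D - m) <= cRe (y * x).
Proof.
move=> D0 mD xy Dx.
have -> : y * x = Complex (cmod x ^+ 2) 0 - x * conjc (x - conjc y).
  by rewrite conjcB conjcK -mulcJ; ring.
have -> : forall u : R[i], cRe (Complex (cmod x ^+ 2) 0 - u) = cmod x ^+ 2 - cRe u by case.
have h := norm_Re_le_cmod (x * conjc (x - conjc y)).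
rewrite cmodM cmod_conj in h.
have h' : cRe (x * conjc (x - conjc y)) <= cmod x * m.
  apply: le_trans (ler_norm _) _; apply: le_trans h _.
  by rewrite ler_wpM2l// cmod_ge0.
have : D * (D - m) <= cmod x * (cmod x - m).
  by apply: ler_pM => //; [rewrite subr_ge0|rewrite lerD2r].
move: h'; rewrite expr2 mulrBr; lra.
Qed.

(** The Poisson integral of $GF$ is $F(z)$ times that of $G$; the former is bounded below near
    $\zeta$ and the latter is bounded, so $F(z)$ stays away from zero. *)
Lemma analytic_factor_lower_bound (F G : R -> R[i]) (c e : R) zeta :
  analytic F -> analytic G -> cmod zeta = 1 -> 0 < c -> 0 < e ->
  {ae lam, forall t, I02 t -> cmod (ceit t - zeta) < e -> c <= cRe (G t * F t)} ->
  exists rho kappa : R, [/\ 0 < rho, 0 < kappa &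
    forall z, disc z -> cmod (z - zeta) < rho -> kappa <= cmod (cauchyI F z)].
Proof.
move=> aF aG zeta1 c0 e0 GFc; have [cF _] := aF; have [cG _] := aG.
have cGF : cbdd (fun t => G t * F t) by exact: cbddM.
have [_ _ [M GM]] := (cbddP _).1 cGF; have M0 := aebd_ge0 _ _ GM.
have [_ _ [M2 GM2]] := (cbddP _).1 cG; have M20 := aebd_ge0 _ _ GM2.
have cM : 0 < c + M by lra.
have e2 : 0 < e ^+ 2 by rewrite exprn_gt0.
(* The radius meets the two smallness conditions of [poisson_lower_bound]. The second value comes
   from $\frac c2\, 2\pi \le |F(z)|\cdot 2 M_2\cdot 2\pi$, with $M_2+1$ keeping the denominator
   positive. *)
exists (Num.min (e / 2) (c * e ^+ 2 / (16 * (c + M)))), (c / (4 * (M2 + 1))).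
have M21 : 0 < 4 * (M2 + 1) by lra.
split.
- rewrite lt_min; apply/andP; split; first exact: divr_gt0.
  by rewrite divr_gt0 ?mulr_gt0.
- exact: divr_gt0.
move=> z zd; rewrite lt_min => /andP[z1 z2].
have H : c / 2 * (2 * pi) <= cmod (cI (fun t => G t * F t * Complex (pois z t) 0)).
  apply: (poisson_lower_bound _ M c e zeta z) => //; first exact: ltW.
  move: z2; rewrite ltr_pdivlMr ?mulr_gt0// => z2.
  have -> : (c + M) * (8 * cmod (z - zeta) / e ^+ 2) =
    cmod (z - zeta) * (16 * (c + M)) / 2 / e ^+ 2 by field; rewrite gt_eqF.
  by rewrite ler_pdivrMr//; lra.
move: H; rewrite cI_analytic_pois_factor// cmodM => H.
have H2 : cmod (cI (fun t => G t * Complex (pois z t) 0)) <= 2 * (M2 * (2 * pi)).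
  rewrite -(Rint_pois z zd) -(RintZ M2 _ (rbdd_pois z zd)).
  apply: cmod_cI_le_Rint.
  - by apply: cbddM => //; exact: cbdd_pois.
  - by apply: rbddM; [exact: rbdd_cst|exact: rbdd_pois].
  - apply: aeS GM2 => t GM2 tI; rewrite cmodM cmod_real ger0_norm ?pois_ge0//.
    by rewrite ler_wpM2r ?pois_ge0 ?GM2.
have pi0 := @pi2_gt0 R; have x0 := cmod_ge0 (cauchyI F z).
rewrite ler_pdivrMr//; set x := cmod (cauchyI F z) in H x0 *.
have : c / 2 * (2 * pi) <= x * (2 * (M2 * (2 * pi))).
  by apply: le_trans H _; rewrite ler_wpM2l.
have -> : x * (2 * (M2 * (2 * pi))) = (x * (2 * M2)) * (2 * pi) by ring.
rewrite ler_pM2r// => H3.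
have : x * (4 * (M2 + 1)) = 2 * (x * (2 * M2)) + 4 * x by ring.
lra.
Qed.

End HardyFunctions.

Theorem theorem4 (R : realType) (phi Phi I : R[i] -> R[i])
  (c : R[i]) (a : nat -> option R[i]) (mu : {measure set R -> \bar R}) :
  Hinf phi -> inner I -> outer Phi ->
  {ae @lebesgue_measure R, forall t, I02 t ->
      phi (ceit t) = Phi (ceit t) * I (ceit t)} ->
  (* I = B S with B the Blaschke product of the zeros a, S singular inner *)
  cmod c = 1 -> blaschke_seq a -> sing_meas mu ->
  (forall z, disc z -> exists bz, blaschke_at a z bz /\
                        ext I z = c * bz * sing_inner mu z) ->
  (forall delta : R, 0 < delta < 1 ->
     intT (levelp Phi delta) `&` spectrum a mu !=set0) ->
  saturated phi.
Proof.
move=> Hphi [HI I1] [[mPhi [_ Phi0]] _] phiE c1 [ad _] [_ [mufin [N [mN [N0 muN]]]]] IE HS.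
apply/eqP; rewrite eq_le; apply/andP; split; last first.
  (* The infimum is at most the norm of [phi], by the choice $f = 0$. *)
  apply: ereal_inf_lbound; exists (fun=> 0); first exact: Hinf0_cst0.
  by congr ess_norm; apply: funext => z; rewrite conjc0 subr0.
apply: le_ereal_inf_tmp => _ [f [Hf _] <-]; rewrite leNgt; apply/negP => lt_norm.
have [M1 [M10 fM1 M1lt]] := ess_norm_lt _ _ lt_norm.
have [[_ phifin] _] := Hphi.
pose n := fine (ess_norm phi).
have nE : ess_norm phi = n%:E by rewrite fineK// ge0_fin_numE// ess_norm_ge0.
have M1n : M1 < n by move: M1lt; rewrite nE lte_fin.
have phimod : {ae @lebesgue_measure R, forall t, I02 t ->
    cmod (Phi (ceit t)) = cmod (phi (ceit t))}.
  by apply: aeS2 phiE I1 => t phiE I1 tI; rewrite phiE// cmodM I1// mulr1.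
have PhiE : ess_norm Phi = n%:E by rewrite (eq_ess_norm _ _ phimod).
(* The midpoint lies strictly between the distance bound [M1] and the norm [n], so $D - M_1 > 0$ and
   the level $D/n$ is admissible. *)
pose D := (M1 + n) / 2.
have n0 : 0 < n by lra.
have D0 : 0 < D by rewrite /D; lra.
have M1D : M1 < D by rewrite /D; lra.
have dd : 0 < D / n < 1.
  by rewrite divr_gt0// ltr_pdivrMr// mul1r /D; lra.
have [zeta [[zeta1 [e [e0 eP]]] [_ spec]]] := HS _ dd.
have aI := Hinf_analytic _ HI; have af := Hinf_analytic _ Hf.
(* An outer function is only assumed to be in $H^1$; its boundedness here comes from $|\Phi| =
   |\varphi|$ a.e. *)
have aPhi : analytic (fun t => Phi (ceit t)).
  apply: fourier_analytic => //; apply: Linf_cbdd => //.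
  have [M [_ phiM _]] := ess_norm_lt _ _ phifin; exists M.
  by apply: aeS2 phimod phiM => t pe pM tI; rewrite pe// pM.
have cc : 0 < D * (D - M1) by rewrite mulr_gt0// subr_gt0.
have both : {ae @lebesgue_measure R, forall t, I02 t ->
    phi (ceit t) = Phi (ceit t) * I (ceit t) /\
    cmod (Phi (ceit t)) = cmod (phi (ceit t))}.
  by apply: aeS2 phiE phimod => t A B tI; split; [exact: A|exact: B].
(* Applied with $F = I$ and $G = f\Phi$, so that $GF = f\varphi$ a.e., whose real part [Re_mul_ge]
   bounds below on the arc. *)
have [|rho [kappa [rho0 kappa0 lowI]]] := analytic_factor_lower_bound
    _ _ _ e zeta aI (analyticM _ _ af aPhi) zeta1 cc e0.
  apply: aeS2 both fM1 => t /[swap] fM /[swap] tI /(_ tI)[A B] te.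
  rewrite -mulrA -A.
  apply: Re_mul_ge; [exact: ltW|exact: ltW|exact: fM|].
  rewrite -B; have [//|_] := eP (ceit t) _ te; first exact: cmod_ceit.
  by rewrite PhiE -EFinM lee_fin mulrCA divff ?mulr1// gt_eqF.
case: spec => [zeros|mass].
  (* A zero within [rho] of [zeta] would make the extension of [I] vanish where its modulus is at
     least [kappa]. *)
  have [k [w [ak wz]]] := zeros _ rho0; have wd := ad _ _ ak.
  have [b [bw Iw]] := IE w wd.
  have := lowI w wd wz; rewrite -ext_cauchyI Iw (blaschke_zero _ _ _ _ ak bw).
  by rewrite mulr0 mul0r cmod0 leNgt kappa0.
have := mass (rho / 2); rewrite divr_gt0// => /(_ isT).
(* As the Blaschke factor has modulus at most 1, $\kappa \le |I(z)| \le \exp(-\int P_z\,d\mu)$,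
   which bounds the Poisson integral of [mu] by $-\ln\kappa$. *)
rewrite (sing_null_of_poisson_bounded mu N zeta rho (- ln kappa)) ?ltxx//.
move=> z zd zz; have [b [bz Iz]] := IE z zd.
have := lowI z zd zz; rewrite -ext_cauchyI Iz !cmodM c1 mul1r cmod_sing_inner// => H.
have : kappa <= expR (- Rintegral mu (@Ico02 R) (pois z)).
  apply: le_trans H _; rewrite ler_piMl ?expR_ge0//.
  exact: cmod_blaschke_le1 ad zd bz.
rewrite lerNr => H2; rewrite -[leRHS]expRK ler_ln// ?posrE ?expR_gt0//.
Qed.
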